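(* Let $(X_n)_{n\ge1}$ be the process $X_n=f_n(\eta_n,\eta_{n-1},\ldots,\eta_0)$ described in the context (integrable and centered), let $S_n=X_1+\cdots+X_n$, and let $U_{k,\ell}$, $T_{k,\ell}$ and $\delta_q^*(n)$ be as defined in the context. Then for every integer $d\ge0$, $$\max_{1\le n\le2^d}|S_n|\le\sum_{k=0}^d\max_{1\le\ell\le2^{d-k}}|U_{k,\ell}|+\sum_{k=0}^d\max_{1\le m\le2^{d-k}}\Big|\sum_{\ell=1}^mT_{k,\ell}\Big|.$$ In particular, if for some $p\ge2$ we have $X_n\in\mathbb{L}^p$ for every $n\ge1$, then for every $d\ge0$, $$\Big\|\max_{1\le n\le2^d}|S_n|\Big\|_p\le\sum_{k=0}^d\Big(\sum_{\ell=1}^{2^{d-k}}\|U_{k,\ell}\|_p^p\Big)^{1/p}+C_p\sum_{k=0}^d\Bigg(\Big(\sum_{\ell=1}^{2^{d-k}}\|T_{k,\ell}\|_2^2\Big)^{1/2}+\Big(\sum_{\ell=1}^{2^{d-k}}\|T_{k,\ell}\|_p^p\Big)^{1/p}\Bigg),$$ and the right-hand side is at most $$C'_p\,2^{d/2}\sum_{j=0}^{2^d}\frac{\delta_2^*(j)}{(j+1)^{1/2}}+C''_p\,2^{d/p}\sum_{j=0}^{2^d}\frac{\delta_p^*(j)}{(j+1)^{1/p}},$$ where $C_p$ is the best constant in the Rosenthal inequality for independent random variables, $C'_p=\dfrac{C_p2^{3/2}}{\sqrt2-1}$ and $C''_p=\dfrac{2^{1+1/p}(C_p+1)}{2^{1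/p}-1}$.
   Context: Let $(\eta_k)_{k\ge0}$ be independent random variables (not necessarily identically distributed). For $k\ge1$ and $0\le\ell\le k-1$ let $\mathcal{G}_{k,\ell}=\sigma\{\eta_k,\eta_{k-1},\ldots,\eta_{k-\ell}\}$. For $n\ge1$ let $X_n=f_n(\eta_n,\eta_{n-1},\ldots,\eta_0)$, where $f_n$ is real-valued and measurable, and assume $\mathbb{E}(|X_n|)<\infty$ and $\mathbb{E}(X_n)=0$ for every $n\ge1$. For $\ell\ge1$ set $T_{0,\ell}=\mathbb{E}(X_\ell|\mathcal{G}_{\ell,0})$. For $k\ge0$ and $\ell\ge1$ set $$U_{k,\ell}=\sum_{j=(\ell-1)2^k+1}^{\ell2^k}\big(X_j-\mathbb{E}(X_j|\mathcal{G}_{\ell2^k,2^k-1})\big),\qquad T_{k+1,\ell}=\mathbb{E}\big(U_{k,2\ell-1}+U_{k,2\ell}\,\big|\,\mathcal{G}_{\ell2^{k+1},2^{k+1}-1}\big).$$ Let $(\eta'_k)_{k\ge0}$ be an independent copy of $(\eta_k)_{k\ge0}$. For $m\ge0$ and $k\ge m+1$ set $X'_{k,m}=f_k(\eta_k,\ldots,\eta_{k-m},\eta'_{k-m-1},\ldots,\eta'_0)$. For $q\ge1$ define $$\delta_q^*(0)=\sup_{k\ge1}\|X_k\|_q,\qquad\delta_q^*(n)=\sup_{m\ge n-1}\ \sup_{k\ge m+1}\|X_k-X'_{k,m}\|_q\quad(n\ge1),$$ where $\|Z\|_q=(\mathbb{E}|Z|^q)^{1/q}$. $C_p$ is the smallest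 constant such that for all $n\ge1$ and all independent centered random variables $\xi_1,\ldots,\xi_n$ in $\mathbb{L}^p$, $$\Big\|\max_{1\le m\le n}\Big|\sum_{i=1}^m\xi_i\Big|\Big\|_p\le C_p\Big(\Big(\sum_{i=1}^n\|\xi_i\|_2^2\Big)^{1/2}+\Big(\sum_{i=1}^n\|\xi_i\|_p^p\Big)^{1/p}\Big).$$ *)

(* Defs.v *)
From HB Require Import structures.
From mathcomp Require Import all_boot all_order all_algebra finmap.
From mathcomp Require Import all_classical all_reals all_analysis.

Set Implicit Arguments.
Unset Strict Implicit.
Unset Printing Implicit Defensive.

Import Order.TTheory GRing.Theory Num.Theory.
Import numFieldNormedType.Exports.

Local Open Scope classical_set_scope.
Local Open Scope ring_scope.

Definition sigma_family d (E : measurableType d) (T I : Type)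
    (Y : I -> T -> E) (D : set I) : set (set T) :=
  <<s \bigcup_(i in D) preimage_set_system setT (Y i) measurable >>.

Definition mutually_independent d d' (T : measurableType d)
    (E : measurableType d') (R : realType) (P : probability T R)
    (I : choiceType) (D : set I) (Y : I -> T -> E) : Prop :=
  forall J : {fset I}, [set` J] `<=` D ->
  forall A : I -> set E, (forall i, measurable (A i)) ->
    P (\bigcap_(i in [set` J]) (Y i @^-1` A i)) =
    (\prod_(i <- J) P (Y i @^-1` A i))%E.

(* The laws of the two processes are compared on the product sigma-algebra
   of nat -> E, generated by the coordinate maps. *)
Definition independent_copy d d' (T : measurableType d)
    (E : measurableType d') (R : realType) (P : probability T R)
    (Y Y' : nat -> T -> E) : Prop :=
  (forall A B : set T, sigma_family Y setT A -> sigma_family Y' setT B ->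
     P (A `&` B) = (P A * P B)%E) /\
  (forall A : set (nat -> E),
     sigma_family (fun k (x : nat -> E) => x k) setT A ->
     P ((fun w k => Y' k w) @^-1` A) = P ((fun w k => Y k w) @^-1` A)).

(* Y is a version of E(X | G); G is meant to be a sub-sigma-algebra. *)
Definition is_condexp d (T : measurableType d) (R : realType)
    (P : probability T R) (G : set (set T)) (X Y : T -> R) : Prop :=
  [/\ forall B : set R, measurable B -> G (Y @^-1` B),
      Y \in Lfun P 1%E
    & forall A : set T, G A ->
        (\int[P]_(w in A) (Y w)%:E = \int[P]_(w in A) (X w)%:E)%E].

Section process.
Context d d' (T : measurableType d) (E : measurableType d') (R : realType).
Implicit Types (f : forall n : nat, n.+1.-tuple E -> R) (eta : nat -> T -> E).

Definition G_ eta (k l : nat) : set (set T) :=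
  sigma_family eta [set i : nat | (k - l <= i <= k)%N].

(* f n takes its arguments in the order eta_n, eta_(n-1), ..., eta_0. *)
Definition X_ f eta (n : nat) (w : T) : R :=
  f n [tuple eta (n - i)%N w | i < n.+1].

Definition X'_ f eta eta' (k m : nat) (w : T) : R :=
  f k [tuple (if (i <= m)%N then eta (k - i)%N w else eta' (k - i)%N w)
      | i < k.+1].

Definition S_ f eta (n : nat) (w : T) : R :=
  \sum_(1 <= i < n.+1) X_ f eta i w.

(* EX k l j stands for a version of E(X_j | G_(l 2^k, 2^k - 1)). *)
Definition U_ f eta (EX : nat -> nat -> nat -> T -> R) (k l : nat) (w : T) :
    R :=
  \sum_(l.-1 * 2 ^ k + 1 <= j < (l * 2 ^ k).+1) (X_ f eta j w - EX k l j w).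

Definition delta_star (P : probability T R) f eta eta' (q : R) (n : nat) :
    \bar R :=
  if n is n'.+1 then
    ereal_sup [set ereal_sup
        [set ('N[P]_q%:E[EFin \o (X_ f eta k \- X'_ f eta eta' k m)%R])%E
        | k in [set k | (m + 1 <= k)%N]]
      | m in [set m | (n' <= m)%N]]
  else
    ereal_sup [set ('N[P]_q%:E[EFin \o X_ f eta k])%E
      | k in [set k | (1 <= k)%N]].

End process.

Definition is_rosenthal_constant (R : realType) (p C : R) : Prop :=
  forall (d : measure_display) (T : measurableType d) (P : probability T R)
    (n : nat) (xi : nat -> {RV P >-> R}),
  (1 <= n)%N ->
  mutually_independent P [set i : nat | (1 <= i <= n)%N] xi ->
  (forall i, (1 <= i <= n)%N ->
     (xi i : T -> R) \in Lfun P p%:E /\ ('E_P[xi i] = 0)%E) ->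
  ('N[P]_p%:E[EFin \o (fun w => \big[Num.max/0]_(1 <= m < n.+1)
                             `|\sum_(1 <= i < m.+1) xi i w|)%R]
   <= C%:E * ((\sum_(1 <= i < n.+1) 'N[P]_2%:E[EFin \o xi i] `^ 2) `^ 2^-1
            + (\sum_(1 <= i < n.+1) 'N[P]_p%:E[EFin \o xi i] `^ p) `^ p^-1))%E.

(* The infimum is attained as soon as it is finite, and by Rosenthal's
   inequality it is finite when 2 <= p: it is then the smallest constant. *)
Definition rosenthal_constant (R : realType) (p : R) : \bar R :=
  ereal_inf [set C%:E | C in is_rosenthal_constant p].

(* Main.v *)
Require Import Defs.
From HB Require Import structures.
From mathcomp Require Import all_boot all_order all_algebra finmap.
From mathcomp Require Import all_classical all_reals all_analysis.
From mathcomp Require Import measurable_realfun.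
From mathcomp Require Import ring lra zify.

Set Implicit Arguments.
Unset Strict Implicit.
Unset Printing Implicit Defensive.

Import Order.TTheory GRing.Theory Num.Theory.
Import numFieldNormedType.Exports.

Local Open Scope classical_set_scope.
Local Open Scope ring_scope.

(** The maximal inequality comes from a dyadic chaining. Subtracting from X_j
    its conditional expectation given the block of length 2^k that contains j
    leaves the remainders summed in U_{k,l}, and T_{k+1,l} is what the
    remainders of two neighbouring blocks lose when the two blocks are merged:
    by uniqueness of conditional expectations, almost surely X_l = T_{0,l} +
    U_{0,l} and U_{k,2l-1} + U_{k,2l} = T_{k+1,l} + U_{k+1,l} ([ae_T0],
    [ae_TS]). Summing U_{k,.} up to n pairs consecutive terms and leaves at
    most one unpaired term, bounded by the maximum of the |U_{k,l}|; the pairs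
    split into a partial sum of the T_{k+1,l} and one of the U_{k+1,l}, which
    is treated at the next level ([max_partial_sums_dyadic], a statement about
    real sequences).

    For the norm inequality, the p-th power of the maximum of the |U_{k,l}| is
    bounded by the sum of their p-th powers. At a fixed level k the T_{k,l} are
    centered and are functions of disjoint blocks of the eta_i, hence
    independent ([mutually_independent_blocks], [T_independent]), and
    Rosenthal's inequality applies to their partial sums. The constant is an
    infimum in the extended reals: it is at least 1/2, as a fair sign shows, so
    that infinite norms on the right make the bound trivial, and it passes to
    the infimum otherwise ([le_rosenthal_constant_mul]); when all norms on the
    right vanish, so does the left-hand side, whatever the value of the
    constant.

    The last bound rests on ||X_j - E(X_j | G)||_q <= delta*_q(m+1), where G is
    generated by the eta_i of the dyadic block of j and m+1 is the rank of j in
    that block. Since the eta_i outside the block are independent of it,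
    replacing the past outside the block by the copy eta' does not change the
    conditional expectation, and enlarging the conditioning to the whole
    sequence eta does not either: E(X_j | G) is a version of E(X'_{j,m} | eta)
    ([condexp_mix]). As X_j is eta-measurable, the difference X_j - E(X_j | G)
    is E(X_j - X'_{j,m} | eta), and conditional expectations contract the norm
    of order q ([Lnorm_condexp_le]). This gives ||U_{k,l}||_q <= delta*_q(1) +
    ... + delta*_q(2^k) and, by contraction again, twice this bound for
    T_{k+1,l}. Exchanging the sums over k and j leaves a geometric series of
    ratio 2^(-1/q) started at the first k with j <= 2^k ([dyadic_weight_le]),
    which produces the stated constants. *)

(** * Integrals of functions of random variables *)

Lemma ge0_integral_mrestr d (T : measurableType d) (R : realType)
    (mu : {measure set T -> \bar R}) (D : set T) (mD : measurable D)
    (f : T -> \bar R) :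
  measurable_fun [set: T] f -> (forall x, 0 <= f x)%E ->
  (\int[mrestr mu mD]_x f x = \int[mu]_(x in D) f x)%E.
Proof.
move=> mf f0.
have mDC : measurable (~` D) by exact: measurableC.
rewrite [LHS](@ge0_negligible_integral _ _ _ _ _ (~` D))//; last first.
  by rewrite /= /mrestr setICl measure0.
rewrite setTD setCK; apply: eq_measure_integral => A mA AD.
by rewrite /= /mrestr setIidl.
Qed.

(** The two sides are integrals of g against finite measures on F, the images of
    the restrictions of P to A and to B, which agree on a generating pi-system.
    With A = B1 `&` B2, B = B1 and c = P B2 this turns independence into a
    factorization of integrals. *)
Lemma ge0_integral_law_restr d d' (Om : measurableType d)
    (F : measurableType d') (R : realType) (P : probability Om R)
    (phi1 phi2 : Om -> F) (A B : set Om) (c : {nonneg R}) (G : set (set F)) :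
  measurable_fun [set: Om] phi1 -> measurable_fun [set: Om] phi2 ->
  measurable A -> measurable B ->
  measurable = <<s G >> -> setI_closed G -> G setT ->
  (forall C, G C -> P (A `&` phi1 @^-1` C) =
                    c%:num%:E * P (B `&` phi2 @^-1` C))%E ->
  forall g : F -> \bar R, measurable_fun [set: F] g -> (forall x, 0 <= g x)%E ->
  (\int[P]_(w in A) g (phi1 w) = c%:num%:E * \int[P]_(w in B) g (phi2 w))%E.
Proof.
move=> mp1 mp2 mA mB mG GI GT eqG g mg g0.
have e1 : (\int[P]_(w in A) g (phi1 w) =
           \int[pushforward (mrestr P mA) phi1]_y g y)%E.
  rewrite ge0_integral_pushforward// preimage_setT ge0_integral_mrestr//.
    exact: measurableT_comp.
  by move=> x /=.
have e2 : (\int[P]_(w in B) g (phi2 w) =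
           \int[pushforward (mrestr P mB) phi2]_y g y)%E.
  rewrite ge0_integral_pushforward// preimage_setT ge0_integral_mrestr//.
    exact: measurableT_comp.
  by move=> x /=.
rewrite e1 e2 -ge0_integral_mscale//.
apply: eq_measure_integral => C mC _.
apply: (measure_unique G (fun=> setT)) => //.
- exact: bigcup_const.
- move=> D GD /=; rewrite /mscale/= /pushforward/= /mrestr.
  by rewrite setIC eqG// [in RHS]setIC.
- move=> k /=; rewrite /pushforward/= /mrestr preimage_setT setTI.
  by rewrite ltey_eq fin_num_measure.
Qed.

Lemma integral_law_restr d d' (Om : measurableType d)
    (F : measurableType d') (R : realType) (P : probability Om R)
    (phi1 phi2 : Om -> F) (A B : set Om) (c : {nonneg R}) (G : set (set F)) :
  measurable_fun [set: Om] phi1 -> measurable_fun [set: Om] phi2 ->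
  measurable A -> measurable B ->
  measurable = <<s G >> -> setI_closed G -> G setT ->
  (forall C, G C -> P (A `&` phi1 @^-1` C) =
                    c%:num%:E * P (B `&` phi2 @^-1` C))%E ->
  forall g : F -> \bar R, measurable_fun [set: F] g ->
  P.-integrable B (g \o phi2) ->
  (\int[P]_(w in A) g (phi1 w) = c%:num%:E * \int[P]_(w in B) g (phi2 w))%E.
Proof.
move=> mp1 mp2 mA mB mG GI GT eqG g mg ig.
rewrite integralE [in RHS]integralE.
under eq_integral do rewrite (funepos_comp g phi1).
under [X in (_ - X)%E]eq_integral do rewrite (funeneg_comp g phi1).
under [X in (_ = _ * (X - _))%E]eq_integral do rewrite (funepos_comp g phi2).
under [X in (_ = _ * (_ - X))%E]eq_integral do rewrite (funeneg_comp g phi2).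
rewrite (ge0_integral_law_restr mp1 mp2 mA mB mG GI GT eqG
           (g := funepos g))//; last exact: measurable_funepos.
rewrite (ge0_integral_law_restr mp1 mp2 mA mB mG GI GT eqG
           (g := funeneg g))//; last exact: measurable_funeneg.
rewrite [in RHS]muleBr// fin_num_adde_defl//.
by rewrite fin_numN -funeneg_comp integrable_neg_fin_num.
Qed.

(** * Norms *)

Section Lnorm_tools.
Context d (T : measurableType d) (R : realType) (P : probability T R).
Implicit Types q : R.

Lemma Lfun1_measurable (f : T -> R) : f \in Lfun P 1%E ->
  measurable_fun [set: T] f.
Proof. by move/Lfun1_integrable/measurable_int/measurable_EFinP. Qed.

Lemma measurable_norm_powR q (h : T -> R) : measurable_fun [set: T] h ->
  measurable_fun [set: T] (fun x => (`|h x| `^ q)%:E).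
Proof.
move=> mh; apply/measurable_EFinP.
apply: (measurableT_comp (measurable_powR q)); exact: measurableT_comp.
Qed.

Lemma Lnorm_fin_Lfun q (f : T -> R) : measurable_fun [set: T] f ->
  ('N[P]_q%:E[EFin \o f] < +oo)%E -> f \in Lfun P q%:E.
Proof. by move=> mf Nf; rewrite inE; apply/andP; split; rewrite inE. Qed.

Lemma measurable_bigmax (r : seq nat) (F : nat -> T -> R) :
  (forall i, i \in r -> measurable_fun [set: T] (F i)) ->
  measurable_fun [set: T] (fun w => \big[Num.max/0]_(i <- r) F i w).
Proof.
elim: r => [|i r IH] mF.
  by under eq_fun do rewrite big_nil; exact: measurable_cst.
under eq_fun do rewrite big_cons; apply: measurable_maxr.
  by apply: mF; rewrite mem_head.
by apply: IH => j jr; apply: mF; rewrite inE jr orbT.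
Qed.

Lemma measurable_sum_seq (r : seq nat) (F : nat -> T -> R) :
  (forall i, i \in r -> measurable_fun [set: T] (F i)) ->
  measurable_fun [set: T] (fun w => \sum_(i <- r) F i w).
Proof.
elim: r => [|i r IH] mF.
  by under eq_fun do rewrite big_nil; exact: measurable_cst.
under eq_fun do rewrite big_cons; apply: measurable_funD.
  by apply: mF; rewrite mem_head.
by apply: IH => j jr; apply: mF; rewrite inE jr orbT.
Qed.

Lemma le_Lnorm_ae q (f g : T -> R) : 0 < q ->
  measurable_fun [set: T] f -> measurable_fun [set: T] g ->
  {ae P, forall w, `|f w| <= `|g w|} ->
  ('N[P]_q%:E[EFin \o f] <= 'N[P]_q%:E[EFin \o g])%E.
Proof.
move=> q0 mf mg fg.
rewrite unlock /=; apply: gt0_ler_poweR.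
- by rewrite invr_ge0 ltW.
- by rewrite in_itv/= leey andbT integral_ge0// => x _; exact: poweR_ge0.
- by rewrite in_itv/= leey andbT integral_ge0// => x _; exact: poweR_ge0.
- apply: ae_ge0_le_integral => //=.
  + by apply: measurable_norm_powR.
  + by apply: measurable_norm_powR.
  + apply: filterS fg => w fgw _; rewrite lee_fin.
    by apply: ge0_ler_powR => //; rewrite ?nnegrE ?ltW.
Qed.

Lemma Lnorm_sum_le q (r : seq nat) (F : nat -> T -> R) :
  (forall i, i \in r -> measurable_fun [set: T] (F i)) -> 1 <= q ->
  ('N[P]_q%:E[EFin \o (fun w => \sum_(i <- r) F i w)%R]
   <= \sum_(i <- r) 'N[P]_q%:E[EFin \o F i])%E.
Proof.
move=> + q1; elim: r => [|i r IH] mF.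
  rewrite big_nil (_ : _ \o _ = cst 0%E); last first.
    by apply/funext => w; rewrite /= big_nil.
  by rewrite Lnorm0// eqe gt_eqF// (lt_le_trans ltr01).
rewrite big_cons.
have -> : (fun w => \sum_(j <- i :: r) F j w) =
          F i \+ (fun w => \sum_(j <- r) F j w).
  by apply/funext => w; rewrite /= big_cons.
apply: le_trans (minkowski_EFin _ _ _ _) _ => //.
- by apply: mF; rewrite mem_head.
- by apply: measurable_sum_seq => j jr; apply: mF; rewrite inE jr orbT.
- by apply: leeD => //; apply: IH => j jr; apply: mF; rewrite inE jr orbT.
Qed.

(** The power of a maximum is at most the sum of the powers. *)
Lemma Lnorm_bigmax_le q (r : seq nat) (F : nat -> T -> R) : 0 < q ->
  (forall i, i \in r -> measurable_fun [set: T] (F i)) ->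
  ('N[P]_q%:E[EFin \o (fun w => \big[Num.max/0]_(i <- r) `|F i w|)%R]
   <= (\sum_(i <- r) 'N[P]_q%:E[EFin \o F i] `^ q) `^ q^-1)%E.
Proof.
move=> q0 mF.
have mM : measurable_fun [set: T] (fun w => \big[Num.max/0]_(i <- r) `|F i w|).
  by apply: measurable_bigmax => i ir; apply: measurableT_comp => //; exact: mF.
rewrite {1}unlock; apply: gt0_ler_poweR.
- by rewrite invr_ge0 ltW.
- by rewrite in_itv/= leey andbT integral_ge0// => x _; exact: poweR_ge0.
- by rewrite in_itv/= leey andbT sume_ge0// => i _; exact: poweR_ge0.
under [leRHS]eq_bigr do rewrite poweR_Lnorm ?gt_eqF//.
elim: r mF mM => [|i r IH] mF mM.
  rewrite big_nil (eq_integral (cst 0%E)) ?integral0// => w _.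
  by rewrite /= big_nil normr0 powR0// gt_eqF.
have mFi : measurable_fun [set: T] (F i) by apply: mF; rewrite mem_head.
have mFr j : j \in r -> measurable_fun [set: T] (F j).
  by move=> jr; apply: mF; rewrite inE jr orbT.
have mMr : measurable_fun [set: T] (fun w => \big[Num.max/0]_(i <- r) `|F i w|).
  apply: measurable_bigmax => j jr.
  by apply: measurableT_comp => //; exact: mFr.
rewrite big_cons; apply: le_trans (leeD (lexx _) (IH mFr mMr)).
rewrite -ge0_integralD//=; last 2 first.
- exact: measurable_norm_powR.
- exact: measurable_norm_powR.
apply: ge0_le_integral => //=.
- exact: measurable_norm_powR.
- by apply: emeasurable_funD; exact: measurable_norm_powR.
- move=> w _; rewrite big_cons -EFinD lee_fin.
  case: (leP `|F i w| (\big[Num.max/0]_(j <- r) `|F j w|)) => _.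
    by rewrite lerDr powR_ge0.
  by rewrite normr_id lerDl powR_ge0.
Qed.

End Lnorm_tools.

(** The graph of w |-> w ^ q lies above its tangent at y: Young's inequality
    applied to w and y ^ (q - 1). *)
Lemma powR_tangent (R : realType) (q y w : R) :
  1 <= q -> 0 <= y -> 0 <= w ->
  q * (y `^ (q - 1) * w) <= w `^ q + (q - 1) * y `^ q.
Proof.
rewrite le_eqVlt => /predU1P[<- y0 w0|q1 y0 w0].
  by rewrite subrr powRr0 !mul1r mul0r addr0 powRr1.
have q0 : 0 < q by exact: lt_trans q1.
have q10 : 0 < q - 1 by rewrite subr_gt0.
have := @conjugate_powR _ w (y `^ (q - 1)) q (q / (q - 1)) w0 (powR_ge0 _ _)
  q0 (divr_gt0 q0 q10).
rewrite -powRrM mulrCA divff ?gt_eqF// mulr1 invf_div => H.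
have {}H : w * y `^ (q - 1) <= w `^ q / q + y `^ q * ((q - 1) / q).
  by apply: H; field; rewrite gt_eqF.
have -> : w `^ q + (q - 1) * y `^ q
          = q * (w `^ q / q + y `^ q * ((q - 1) / q)).
  by field; rewrite gt_eqF.
by rewrite ler_pM2l// mulrC.
Qed.

(** Cut the range of V into intervals [kh, (k+1)h[. On the event A k that V
    falls in the k-th interval, W has mean at least that of V, hence at least
    kh, so the tangent inequality at y = kh gives that the integral of W ^ q is
    at least (kh) ^ q P (A k). As kh >= V - h there, summing over k bounds the
    norm of (V - h)^+ by that of W; Minkowski's inequality adds back h, and h
    tends to 0. *)
Lemma le_Lnorm_of_le_integral d (T : measurableType d) (R : realType)
    (P : probability T R) (V W : T -> R) (q : R) :
  1 <= q ->
  measurable_fun [set: T] V -> measurable_fun [set: T] W ->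
  (forall x, 0 <= V x) -> (forall x, 0 <= W x) ->
  (forall B, measurable B -> (\int[P]_(x in V @^-1` B) (V x)%:E <=
                             \int[P]_(x in V @^-1` B) (W x)%:E)%E) ->
  ('N[P]_q%:E[EFin \o V] <= 'N[P]_q%:E[EFin \o W])%E.
Proof.
move=> q1 mV mW V0 W0 VW.
have q0 : 0 < q by exact: lt_le_trans q1.
have mpq (f : T -> R) : measurable_fun [set: T] f ->
    measurable_fun [set: T] (fun x => (f x `^ q)%:E).
  move=> mf; apply/measurable_EFinP.
  exact: (measurableT_comp (measurable_powR q)).
apply/lee_addgt0Pr => h h0; have h0' := ltW h0; have q0' := ltW q0.
pose A (k : nat) := V @^-1` `[k%:R * h, k.+1%:R * h[.
have mA k : measurable (A k).
  by rewrite /A -[_ @^-1` _]setTI; exact: mV.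
have tA : trivIset setT A.
  apply/trivIsetP => i j _ _ ij; apply/seteqP; split => // x [].
  rewrite /A/= !in_itv/= => /andP[i1 i2] /andP[j1 j2].
  have := le_lt_trans i1 j2; have := le_lt_trans j1 i2.
  rewrite !ltr_pM2r// !ltr_nat !ltnS => ji ji'.
  by move: ij; rewrite eqn_leq ji ji'.
have UA : \bigcup_k A k = [set: T].
  apply/seteqP; split => // x _; exists (Num.truncn (V x / h)) => //.
  rewrite /A/= in_itv/=.
  have /truncn_itv/andP[a b] : 0 <= V x / h by rewrite divr_ge0// ltW.
  by rewrite -ler_pdivlMr// a -ltr_pdivrMr// b.
have step k : (\int[P]_(x in A k) ((k%:R * h) `^ q)%:E <=
               \int[P]_(x in A k) (W x `^ q)%:E)%E.
  set y := k%:R * h.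
  have y0 : 0 <= y by rewrite mulr_ge0// ltW.
  have PA : P (A k) \is a fin_num by exact: fin_num_measure.
  have yW : (y%:E * P (A k) <= \int[P]_(x in A k) (W x)%:E)%E.
    rewrite -integral_cst//; apply: le_trans (VW _ _) => //.
    apply: ge0_le_integral => //.
    - by apply/measurable_EFinP; apply: measurable_funTS.
    - by move=> x; rewrite /A/= in_itv/= lee_fin => /andP[].
  have Htan : (\int[P]_(x in A k) (q * (y `^ (q - 1) * W x))%:E <=
      \int[P]_(x in A k) ((W x `^ q)%:E + ((q - 1) * y `^ q)%:E))%E.
    apply: ge0_le_integral => //.
    - move=> x _; rewrite lee_fin !mulr_ge0// ?powR_ge0// ltW//.
    - apply/measurable_EFinP; apply: measurable_funTS.
      by do 2 apply: measurable_funM => //.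
    - apply: emeasurable_funD => //; exact: measurable_funTS (mpq _ mW).
    - by move=> x _; rewrite -EFinD lee_fin powR_tangent.
  move: Htan; rewrite ge0_integralD//; last 3 first.
  - by move=> x _; rewrite lee_fin powR_ge0.
  - exact: measurable_funTS (mpq _ mW).
  - by move=> x _; rewrite lee_fin mulr_ge0 ?powR_ge0// subr_ge0.
  have -> : (\int[P]_(x in A k) (q * (y `^ (q - 1) * W x))%:E =
      q%:E * ((y `^ (q - 1))%:E * \int[P]_(x in A k) (W x)%:E))%E.
    rewrite muleA -EFinM -ge0_integralZl_EFin//.
    - by apply: eq_integral => x _; rewrite -EFinM mulrA.
    - by move=> x _; rewrite lee_fin.
    - by apply/measurable_EFinP; apply: measurable_funTS.
    - by rewrite mulr_ge0 ?powR_ge0// ltW.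
  have Ic (r : \bar R) : (\int[P]_(x in A k) r = r * P (A k))%E.
    exact: (integral_cst P (mA k)).
  rewrite !Ic => Htan.
  have {}yW : (q%:E * ((y `^ (q - 1))%:E * (y%:E * P (A k))) <=
       \int[P]_(x in A k) (W x `^ q)%:E + ((q - 1) * y `^ q)%:E * P (A k))%E.
    apply: le_trans Htan; rewrite lee_pmul2l// lee_wpmul2l//.
    by rewrite lee_fin powR_ge0.
  move: yW; rewrite -(fineK PA) -!EFinM => yW.
  have yq : y `^ (q - 1) * y = y `^ q.
    by rewrite mulrC mulr_powRB1.
  rewrite (mulrA (y `^ _)) yq in yW.
  rewrite -leeBlDr// -EFinB in yW.
  apply: le_trans yW; rewrite lee_fin; lra.
set Vh : T -> R := (fun x => Num.max (V x - h) 0).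
have mVh : measurable_fun [set: T] Vh.
  by apply: measurable_maxr => //; exact: measurable_funB.
have Vh0 x : 0 <= Vh x by rewrite le_max lexx orbT.
have intVh : (\int[P]_x (Vh x `^ q)%:E <= \int[P]_x (W x `^ q)%:E)%E.
  have intA (g : T -> R) : measurable_fun [set: T] g ->
      (\int[P]_x (g x `^ q)%:E =
       \sum_(0 <= k <oo) \int[P]_(x in A k) (g x `^ q)%:E)%E.
    move=> mg; rewrite -[in LHS]UA.
    apply: (ge0_integral_bigcup P mA _ _ tA); first by rewrite UA; exact: mpq.
    by move=> x _; rewrite lee_fin powR_ge0.
  rewrite (intA _ mVh) (intA _ mW).
  apply: lee_nneseries => [k _ _|k _].
    by apply: integral_ge0 => x _; rewrite lee_fin powR_ge0.
  apply: le_trans (step k); apply: ge0_le_integral => //.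
  - by move=> x _; rewrite lee_fin powR_ge0.
  - exact: measurable_funTS (mpq _ mVh).
  - move=> x; rewrite /A/= in_itv/= => /andP[k1 k2].
    rewrite lee_fin; apply: ge0_ler_powR; rewrite ?nnegrE ?mulr_ge0//.
    rewrite /Vh ge_max mulr_ge0// andbT lerBlDr (le_trans (ltW k2))//.
    by rewrite -natr1 mulrDl mul1r.
have VhW : ('N[P]_q%:E[EFin \o Vh] <= 'N[P]_q%:E[EFin \o W])%E.
  rewrite unlock /=; apply: gt0_ler_poweR.
  - by rewrite invr_ge0 ltW.
  - by rewrite in_itv/= leey andbT integral_ge0// => x _; exact: poweR_ge0.
  - by rewrite in_itv/= leey andbT integral_ge0// => x _; exact: poweR_ge0.
  - under eq_integral do rewrite ger0_norm ?Vh0//.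
    by under [leRHS]eq_integral do rewrite ger0_norm ?W0//.
have VVh : ('N[P]_q%:E[EFin \o V] <= 'N[P]_q%:E[EFin \o (Vh \+ cst h)%R])%E.
  apply: le_Lnorm_ae => //; first exact: measurable_funD.
  apply: nearW => x; rewrite ger0_norm// ger0_norm ?addr_ge0//.
  by rewrite -lerBlDr le_max lexx.
apply: (le_trans VVh).
apply: le_trans (minkowski_EFin _ _ _ _) _ => //.
apply: leeD => //.
rewrite unlock /=; under eq_integral do rewrite gtr0_norm//.
rewrite (integral_cst P measurableT) [X in (_ * X)%E](probability_setT P).
rewrite mule1.
by rewrite poweR_EFin lee_fin -powRrM divff ?gt_eqF// powRr1.
Qed.

(** * Conditional expectations *)

Lemma sigma_algebra_setT (T : pointedType) (G : set (set T)) : <<s G >> setT.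
Proof. exact: (@measurableT _ (g_sigma_algebraType G)). Qed.

(** Gives access to the closure properties of measurable functions for the
    sub-sigma-algebra generated by G. *)
Lemma measurable_g_sigmaP d (T : pointedType) (F : measurableType d)
    (G : set (set T)) (Y : T -> F) :
  measurable_fun [set: g_sigma_algebraType G] (Y : g_sigma_algebraType G -> F)
  <-> forall B : set F, measurable B -> <<s G >> (Y @^-1` B).
Proof.
split=> [mY B mB|mY _ B mB]; last by rewrite setTI; exact: mY.
by have := mY measurableT B mB; rewrite setTI.
Qed.

Section conditional_expectation.
Context d (T : measurableType d) (R : realType) (P : probability T R).
Variable G : set (set T).
Hypothesis mG : <<s G >> `<=` measurable.
Implicit Types X Y : T -> R.
Local Notation L1 := (Lfun P 1%E).

Lemma condexp_L1 X Y : is_condexp P <<s G >> X Y -> Y \in L1.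
Proof. by case. Qed.

Lemma condexp_id Y : (forall B, measurable B -> <<s G >> (Y @^-1` B)) ->
  Y \in L1 -> is_condexp P <<s G >> Y Y.
Proof. by []. Qed.

Lemma L1_integrableS X A : X \in L1 -> measurable A ->
  P.-integrable A (EFin \o X).
Proof.
by move=> /Lfun1_integrable iX mA; exact: (integrableS measurableT).
Qed.

Lemma Lfun1B X Y : X \in L1 -> Y \in L1 -> X \- Y \in L1.
Proof. by move=> iX iY; exact: rpredB. Qed.

Lemma condexpB X1 X2 Y1 Y2 : X1 \in L1 -> X2 \in L1 ->
  is_condexp P <<s G >> X1 Y1 -> is_condexp P <<s G >> X2 Y2 ->
  is_condexp P <<s G >> (X1 \- X2) (Y1 \- Y2).
Proof.
move=> iX1 iX2 [mY1 iY1 E1] [mY2 iY2 E2]; split.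
- apply/measurable_g_sigmaP; apply: measurable_funB; exact/measurable_g_sigmaP.
- exact: rpredB.
- move=> A GA; have mA := mG GA.
  rewrite (integralB_EFin mA)//; [|exact: L1_integrableS..].
  by rewrite (integralB_EFin mA) ?E1 ?E2//; exact: L1_integrableS.
Qed.

Lemma condexp0 : is_condexp P <<s G >> (cst 0) (cst 0).
Proof.
split=> //; last exact: Lfun_cst.
by apply/measurable_g_sigmaP; exact: measurable_cst.
Qed.

Lemma condexpD X1 X2 Y1 Y2 : X1 \in L1 -> X2 \in L1 ->
  is_condexp P <<s G >> X1 Y1 -> is_condexp P <<s G >> X2 Y2 ->
  is_condexp P <<s G >> (X1 \+ X2) (Y1 \+ Y2).
Proof.
move=> iX1 iX2 [mY1 iY1 E1] [mY2 iY2 E2]; split.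
- apply/measurable_g_sigmaP; apply: measurable_funD; exact/measurable_g_sigmaP.
- exact: rpredD.
- move=> A GA; have mA := mG GA.
  rewrite (integralD_EFin mA)//; [|exact: L1_integrableS..].
  by rewrite (integralD_EFin mA) ?E1 ?E2//; exact: L1_integrableS.
Qed.

Lemma Lfun1_sum (X : nat -> T -> R) (r : seq nat) :
  (forall i, i \in r -> X i \in L1) ->
  (fun w => \sum_(i <- r) X i w) \in L1.
Proof.
move=> iX.
rewrite (_ : (fun w => \sum_(i <- r) X i w) = \sum_(i <- r) X i).
  by rewrite big_seq; apply: rpred_sum => i; exact: iX.
by apply/funext => w; rewrite fct_sumE.
Qed.

Lemma condexp_sum (X Y : nat -> T -> R) (r : seq nat) :
  (forall i, i \in r -> X i \in L1) ->
  (forall i, i \in r -> is_condexp P <<s G >> (X i) (Y i)) ->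
  is_condexp P <<s G >> (fun w => \sum_(i <- r) X i w)
                        (fun w => \sum_(i <- r) Y i w).
Proof.
elim: r => [|i r IH] iX XY.
  under eq_fun do rewrite big_nil.
  under [X in is_condexp _ _ _ X]eq_fun do rewrite big_nil.
  exact: condexp0.
have {}IH : is_condexp P <<s G >> (fun w => \sum_(i <- r) X i w)
                        (fun w => \sum_(i <- r) Y i w).
  by apply: IH => j jr; [apply: iX|apply: XY]; rewrite inE jr orbT.
under eq_fun do rewrite big_cons.
under [X in is_condexp _ _ _ X]eq_fun do rewrite big_cons.
apply: condexpD => //.
- by apply: iX; rewrite mem_head.
- by apply: Lfun1_sum => j jr; apply: iX; rewrite inE jr orbT.
- by apply: XY; rewrite mem_head.
Qed.

(** Jensen's inequality for the power q. On an event A defined by |Y|, splitting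
    according to the sign of Y shows that the integral of |Y| over A, which is
    that of X up to sign on each piece, is at most the integral of |X|. *)
Lemma Lnorm_condexp_le X Y (q : R) : 1 <= q -> X \in L1 ->
  is_condexp P <<s G >> X Y ->
  ('N[P]_q%:E[EFin \o Y] <= 'N[P]_q%:E[EFin \o X])%E.
Proof.
move=> q1 iX [mY iY E].
have mfX := Lfun1_measurable iX; have mfY := Lfun1_measurable iY.
rewrite -[leLHS]Lnorm_abse -[leRHS]Lnorm_abse.
apply: (le_Lnorm_of_le_integral (V := Num.norm \o Y)
  (W := Num.norm \o X)) => //.
  1,2: exact: measurableT_comp.
  1,2: by move=> x; exact: normr_ge0.
move=> B mB.
set A := _ @^-1` B.
have GA : <<s G >> A.
  have /measurable_g_sigmaP : forall B : set R, measurable B ->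
      <<s G >> (Y @^-1` B) by exact: mY.
  move=> /(measurableT_comp (@normr_measurable R setT)).
  by move/measurable_g_sigmaP; exact.
pose Ap := A `&` Y @^-1` `[0, +oo[; pose An := A `&` Y @^-1` `]-oo, 0[.
have GAp : <<s G >> Ap.
  apply: (@measurableI _ (g_sigma_algebraType G)) => //; exact: mY.
have GAn : <<s G >> An.
  apply: (@measurableI _ (g_sigma_algebraType G)) => //; exact: mY.
have AE : A = Ap `|` An.
  rewrite -setIUr; apply/seteqP; split => [x Ax|x []//]; split => //=.
  by rewrite !in_itv/= andbT; case: (leP 0 (Y x)) => _; [left|right].
have dA : [disjoint Ap & An].
  apply/disj_setPS => x [[_ /=] + [_ /=]].
  by rewrite !in_itv/= andbT => /le_lt_trans /[apply]; rewrite ltxx.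
have int_abs S f : measurable S -> f \in L1 ->
    (`|\int[P]_(x in S) (f x)%:E| <= \int[P]_(x in S) (`|f x|)%:E)%E.
  move=> mS iF; apply: le_trans (le_abse_integral _ _ _) _ => //.
  by have /measurable_int := L1_integrableS iF mS.
have mN (f : T -> R) (S : set T) : measurable_fun [set: T] f ->
    measurable_fun S (fun x => `|f x|%:E).
  move=> mf; apply/measurable_EFinP; apply: measurable_funTS.
  exact: measurableT_comp.
have mAp := mG GAp; have mAn := mG GAn.
have n0 (f : T -> R) x : (0 <= ((Num.norm \o f) x)%:E)%E.
  by rewrite lee_fin normr_ge0.
rewrite AE ge0_integral_setU//; last exact: mN.
rewrite [leRHS]ge0_integral_setU//; last exact: mN.
apply: leeD.
- rewrite (_ : (\int[P]_(x in Ap) _ = \int[P]_(x in Ap) (Y x)%:E)%E).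
    by rewrite E//; apply: le_trans (lee_abs _) (int_abs _ _ _ _).
  apply: eq_integral => x; rewrite inE => -[_ /=].
  by rewrite in_itv/= andbT => Y0; rewrite ger0_norm.
- rewrite (_ : (\int[P]_(x in An) _ = - \int[P]_(x in An) (Y x)%:E)%E).
    rewrite E//; apply: le_trans (lee_abs _) _; rewrite abseN.
    exact: int_abs.
  rewrite -integralN; last first.
    exact: (integrable_add_def mAn (L1_integrableS iY mAn)).
  apply: eq_integral => x; rewrite inE => -[_ /=].
  by rewrite in_itv/= => Y0; rewrite ltr0_norm.
Qed.

(** The difference of two versions is a conditional expectation of 0, so its
    norm of order 1 vanishes. *)
Lemma condexp_ae_unique X Y1 Y2 : X \in L1 ->
  is_condexp P <<s G >> X Y1 -> is_condexp P <<s G >> X Y2 ->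
  {ae P, forall w, Y1 w = Y2 w}.
Proof.
move=> iX XY1 XY2.
have H := condexpB iX iX XY1 XY2.
have iXX : X \- X \in L1 by exact: rpredB.
have := Lnorm_condexp_le (lexx 1) iXX H.
rewrite (_ : EFin \o (X \- X) = cst 0%E); last first.
  by apply/funext => w /=; rewrite subrr.
rewrite Lnorm0 ?oner_eq0// => N0.
have {}N0 : ('N[P]_1%:E[EFin \o (Y1 \- Y2)%R] = 0)%E.
  by apply/eqP; rewrite eq_le N0 Lnorm_ge0.
have mY : measurable_fun [set: T] (EFin \o (Y1 \- Y2)).
  by move/condexp_L1/Lfun1_integrable/measurable_int : H.
have := Lnorm_eq0_eq0 mY lte01 N0.
by apply: filterS => w /(_ I) /= [] /eqP; rewrite subr_eq0 => /eqP.
Qed.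

End conditional_expectation.

(** * Independence of disjoint blocks *)

Section independence.
Context d d' (Om : measurableType d) (E : measurableType d') (R : realType).
Variable P : probability Om R.
Implicit Types (Y : nat -> Om -> E) (D : set nat).

(** The finitely many constraints are recorded by a sequence of sets equal to
    setT outside D and beyond some rank, so that an intersection of cylinders is
    taken termwise. *)
Definition cylinders Y D : set (set Om) := [set A | exists B : nat -> set E,
  [/\ forall i, measurable (B i), forall i, ~ D i -> B i = setT,
      exists n, forall i, (n <= i)%N -> B i = setT
    & A = [set w | forall i, B i (Y i w)]]].

Lemma cylinders_setT Y D : cylinders Y D setT.
Proof.
by exists (fun=> setT); split=> //; [exists 0%N|apply/seteqP; split].
Qed.

Lemma cylinders_setI Y D : setI_closed (cylinders Y D).
Proof.
move=> _ _ [B1 [mB1 DB1 [n1 nB1] ->]] [B2 [mB2 DB2 [n2 nB2] ->]].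
exists (fun i => B1 i `&` B2 i); split=> [i|i Di||].
- exact: measurableI.
- by rewrite DB1// DB2// setTI.
- exists (maxn n1 n2) => i; rewrite geq_max => /andP[i1 i2].
  by rewrite nB1// nB2// setTI.
- apply/seteqP; split=> w /=; first by move=> [w1 w2] i; split.
  by move=> w12; split=> i; have [] := w12 i.
Qed.

Lemma sigma_family_sub Y (G : set (set Om)) D :
  (forall i, D i -> forall A, measurable A -> <<s G >> (Y i @^-1` A)) ->
  sigma_family Y D `<=` <<s G >>.
Proof.
move=> YG; apply: smallest_sub; first exact: smallest_sigma_algebra.
by apply: bigcup_sub => i Di _ [A mA <-]; rewrite setTI; exact: YG.
Qed.

Lemma sigma_family_gen Y D i A : D i -> measurable A ->
  sigma_family Y D (Y i @^-1` A).
Proof.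
move=> Di mA; apply: sub_sigma_algebra; exists i => //.
by exists A => //; rewrite setTI.
Qed.

Lemma sigma_family_mono Y D D' : D `<=` D' ->
  sigma_family Y D `<=` sigma_family Y D'.
Proof.
by move=> DD'; apply: sigma_family_sub => i /DD' Di A; exact: sigma_family_gen.
Qed.

Lemma sigma_family_setI Y D A B : sigma_family Y D A -> sigma_family Y D B ->
  sigma_family Y D (A `&` B).
Proof. exact: (@measurableI _ (g_sigma_algebraType _)). Qed.

Lemma sigma_family_setT Y D : sigma_family Y D setT.
Proof. exact: sigma_algebra_setT. Qed.

Lemma sigma_family_box Y D (B : nat -> set E) :
  (forall i, D i -> measurable (B i)) ->
  (forall i, ~ D i -> B i = setT) ->
  sigma_family Y D [set w | forall i, B i (Y i w)].
Proof.
move=> mB DB.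
rewrite (_ : mkset _ = \bigcap_i (Y i @^-1` B i)); last first.
  by apply/seteqP; split=> [w H i _|w H i]; exact: H.
apply: (@bigcapT_measurable _ (g_sigma_algebraType _)) => i.
have [Di|nDi] := pselect (D i); first exact: sigma_family_gen (mB i Di).
by rewrite DB// preimage_setT; exact: measurableT.
Qed.

Lemma sigma_family_cylinders Y D : sigma_family Y D = <<s cylinders Y D >>.
Proof.
apply/seteqP; split.
  apply: sigma_family_sub => i Di A mA; apply: sub_sigma_algebra.
  exists (fun j => if j == i then A else setT); split => [j|j nDj||].
  - by case: ifP.
  - by case: eqP => // ji; move: nDj; rewrite ji.
  - by exists i.+1 => j ij; rewrite gtn_eqF.
  - apply/seteqP; split => w /=; first by move=> wA j; case: eqP => // ->.
    by move=> /(_ i); rewrite eqxx.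
apply: smallest_sub; first exact: smallest_sigma_algebra.
move=> _ [B [mB DB _ ->]]; exact: sigma_family_box.
Qed.

Lemma sigma_family_measurable Y D : (forall i, measurable_fun setT (Y i)) ->
  sigma_family Y D `<=` measurable.
Proof.
move=> mY; apply: smallest_sub; first exact: sigma_algebra_measurable.
by apply: bigcup_sub => i Di _ [A mA <-]; exact: mY.
Qed.

(** For B fixed, A |-> P (A `&` B) and A |-> P A * P B are finite measures that
    agree on a generating pi-system. *)
Lemma independent_sigma_algebra1 (G : set (set Om)) (B : set Om) :
  setI_closed G -> G setT -> G `<=` measurable -> measurable B ->
  (forall A, G A -> P (A `&` B) = P A * P B)%E ->
  forall A, <<s G >> A -> P (A `&` B) = (P A * P B)%E.
Proof.
move=> GI GT mG mB GB A GA.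
have PB0 : 0 <= fine (P B) by rewrite fine_ge0.
pose c : {nonneg R} := NngNum PB0.
have cU : \bigcup_(k : nat) [set: Om] = [set: Om] by exact: bigcup_const.
have := @g_sigma_algebra_measure_unique _ _ _ _ mG (fun=> setT) (fun=> GT) cU
  (mrestr P mB) (mscale c P) GI _ _ _ GA.
rewrite /= /mscale/= /mrestr fineK ?fin_num_measure// muleC; apply => //.
- by move=> C GC; rewrite GB// muleC.
- by move=> _; rewrite setTI ltey_eq fin_num_measure.
Qed.

Lemma independent_sigma_algebra (G H : set (set Om)) :
  setI_closed G -> G setT -> G `<=` measurable ->
  setI_closed H -> H setT -> H `<=` measurable ->
  (forall A B, G A -> H B -> P (A `&` B) = P A * P B)%E ->
  forall A B, <<s G >> A -> <<s H >> B -> P (A `&` B) = (P A * P B)%E.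
Proof.
move=> GI GT mG HI HT mH GH A B sGA sHB.
have mA : measurable A.
  by apply: (smallest_sub _ mG) sGA; exact: sigma_algebra_measurable.
have mB : measurable B.
  by apply: (smallest_sub _ mH) sHB; exact: sigma_algebra_measurable.
apply: (independent_sigma_algebra1 GI GT mG mB) => // {sGA mA}A GA.
rewrite setIC muleC.
apply: (independent_sigma_algebra1 HI HT mH (mG _ GA)) => // C HC.
by rewrite setIC muleC GH.
Qed.

Section family.
Variable Y : nat -> Om -> E.
Hypothesis mY : forall i, measurable_fun setT (Y i).
Hypothesis indY : mutually_independent P [set: nat] Y.

Lemma cylinders_measurable D : cylinders Y D `<=` measurable.
Proof.
move=> A cA; apply: (@sigma_family_measurable Y D) => //.
by rewrite sigma_family_cylinders; exact: sub_sigma_algebra.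
Qed.

Lemma independent_box (B : nat -> set E) n : (forall i, measurable (B i)) ->
  (forall i, (n <= i)%N -> B i = setT) ->
  P [set w | forall i, B i (Y i w)]
  = (\prod_(0 <= i < n) P (Y i @^-1` B i))%E.
Proof.
move=> mB nB.
have := indY (J := [fset x | x in iota 0 n]%fset) (fun _ _ => I) mB.
rewrite (_ : \bigcap_(i in _) _ = [set w | forall i, B i (Y i w)]).
  move=> ->; apply: perm_big; apply: uniq_perm; rewrite ?fset_uniq ?iota_uniq//.
  by move=> i; rewrite !inE mem_index_iota mem_iota.
apply/seteqP; split=> w /= H i; last by move=> _; exact: H.
have [ni|ni] := leqP n i; first by rewrite nB.
by apply: H; rewrite /= !inE /= mem_iota.
Qed.

(** For cylinders over disjoint index sets, at each index one of the two
    constraints is void, and the product rule of the family applies. *)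
Lemma independent_blocks D1 D2 A B : D1 `&` D2 = set0 ->
  sigma_family Y D1 A -> sigma_family Y D2 B ->
  P (A `&` B) = (P A * P B)%E.
Proof.
move=> D12; rewrite !sigma_family_cylinders.
apply: independent_sigma_algebra; [exact: cylinders_setI|
  exact: cylinders_setT|exact: cylinders_measurable|exact: cylinders_setI|
  exact: cylinders_setT|exact: cylinders_measurable|].
move=> {}A {}B cA cB.
move: cA cB => [B1 [mB1 DB1 [n1 nB1] ->]] [B2 [mB2 DB2 [n2 nB2] ->]].
pose n := maxn n1 n2.
have n1n : (n1 <= n)%N by exact: leq_maxl.
have n2n : (n2 <= n)%N by exact: leq_maxr.
rewrite (_ : _ `&` _ = [set w | forall i, (B1 i `&` B2 i) (Y i w)]); last first.
  apply/seteqP; split=> w /=; first by move=> [w1 w2] i; split.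
  by move=> w12; split=> i; have [] := w12 i.
rewrite (@independent_box (fun i => B1 i `&` B2 i) n)//; last 2 first.
- by move=> i; exact: measurableI.
- by move=> i ni; rewrite nB1 ?nB2 ?setTI// (leq_trans _ ni).
rewrite (@independent_box B1 n)// ?(@independent_box B2 n)//.
- rewrite -big_split/=; apply: eq_bigr => i _.
  have [D1i|nD1i] := pselect (D1 i).
    rewrite DB2 ?preimage_setT ?setIT ?probability_setT ?mule1//.
    by move=> D2i; suff : (D1 `&` D2) i by rewrite D12.
  by rewrite DB1// preimage_setT setTI probability_setT mul1e.
- by move=> i ni; rewrite nB2// (leq_trans n2n).
- by move=> i ni; rewrite nB1// (leq_trans n1n).
Qed.

(** By induction on the finite subfamily: an intersection of events attached to
    blocks belongs to the sigma-algebra of the union of these blocks, which is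
    disjoint from the next one. *)
Lemma mutually_independent_blocks d2 (F : measurableType d2)
    (K : set nat) (D : nat -> set nat) (Z : nat -> Om -> F) :
  (forall i j, K i -> K j -> i != j -> D i `&` D j = set0) ->
  (forall i, K i -> forall A, measurable A ->
     sigma_family Y (D i) (Z i @^-1` A)) ->
  mutually_independent P K Z.
Proof.
move=> DD ZD J JK A mA.
suff H s : uniq s -> {subset s <= J} ->
    sigma_family Y (\bigcup_(i in [set` s]) D i)
      (\bigcap_(i in [set` s]) (Z i @^-1` A i)) /\
    P (\bigcap_(i in [set` s]) (Z i @^-1` A i)) =
    (\prod_(i <- s) P (Z i @^-1` A i))%E.
  by have [_] := H _ (fset_uniq J) (fun _ => id).
elim: s => [_ _|i s IH /= /andP[nis us] sJ].
  rewrite !classical_sets.set_nil bigcap_set0 big_nil probability_setT.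
  split=> //.
  exact: sigma_family_setT.
have Ji : i \in J by apply: sJ; rewrite mem_head.
have sJ' : {subset s <= J} by move=> j js; apply: sJ; rewrite inE js orbT.
have [IH1 IH2] := IH us sJ'.
have GZ := ZD i (JK i Ji) (A i) (mA i).
have sE : [set` i :: s] = i |` [set` s].
  apply/seteqP; split=> j /=; rewrite inE.
    by move=> /orP[/eqP->|js]; [left|right].
  by move=> [->|js]; apply/orP; [left|right].
rewrite sE bigcap_setU1 bigcup_setU1 big_cons; split.
  apply: sigma_family_setI.
    by apply: sigma_family_mono GZ; left.
  by apply: sigma_family_mono IH1; right.
rewrite -IH2; apply: independent_blocks GZ IH1.
apply/seteqP; split=> // k [Dik [j /= js Djk]].
have ij : i != j by apply: contraNneq nis => ->.
have : (D i `&` D j) k by split.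
by rewrite DD//; apply: JK => //; exact: sJ'.
Qed.

End family.
End independence.

(** * Replacing part of the sequence by an independent copy *)

Lemma eq_integral_pi_system d (T : measurableType d) (R : realType)
    (P : probability T R) (G : set (set T)) (f g : T -> \bar R) :
  setI_closed G -> G setT -> G `<=` measurable ->
  P.-integrable setT f -> P.-integrable setT g ->
  (forall A, G A -> \int[P]_(x in A) f x = \int[P]_(x in A) g x)%E ->
  forall A, <<s G >> A -> (\int[P]_(x in A) f x = \int[P]_(x in A) g x)%E.
Proof.
move=> GI GT mG fi gi fg.
rewrite -(setI_closed_g_dynkin_g_sigma_algebra GI).
suff H : <<d G >> `<=` [set A | measurable A /\
    (\int[P]_(x in A) f x = \int[P]_(x in A) g x)%E].
  by move=> A /H [].
have intU (h : T -> \bar R) A : P.-integrable setT h -> measurable A ->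
    (\int[P]_(x in ~` A) h x = \int[P]_x h x - \int[P]_(x in A) h x)%E.
  move=> hi mA; have mAC := measurableC mA.
  have Afin : (\int[P]_(x in A) h x)%E \is a fin_num.
    by apply: integrable_fin_num => //; exact: integrableS hi.
  rewrite -[X in (\int[P]_(x in X) _ - _)%E](setUv A) integral_setU//.
  - by rewrite addeAC subee// add0e.
  - by rewrite setUv; exact: measurable_int hi.
  - exact/disj_setPCl.
apply: smallest_sub.
  split=> [|A [mA fgA]|F tF HF].
  - by split; [exact: measurableT|exact: fg].
  - split; first exact: measurableC.
    by rewrite !intU// fgA fg.
  - have mF k : measurable (F k) by have [] := HF k.
    have mUF : measurable (\bigcup_k F k) by exact: bigcupT_measurable.
    split=> //; rewrite !integral_bigcup//; last 2 first.
    + exact: integrableS gi.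
    + exact: integrableS fi.
    by apply: eq_eseriesr => k _; have [] := HF k.
by move=> A GA; split; [exact: mG|exact: fg].
Qed.

Definition tuple_boxes d (E : measurableType d) n : set (set (n.-tuple E)) :=
  [set S | exists2 C : 'I_n -> set E, (forall i, measurable (C i)) &
    S = [set x | forall i, C i (tnth x i)]].

Arguments tuple_boxes {d} E n.

Lemma tuple_boxes_setT d (E : measurableType d) n : tuple_boxes E n setT.
Proof. by exists (fun=> setT) => //; apply/seteqP; split. Qed.

Lemma tuple_boxes_setI d (E : measurableType d) n :
  setI_closed (tuple_boxes E n).
Proof.
move=> _ _ [B1 mB1 ->] [B2 mB2 ->].
exists (fun i => B1 i `&` B2 i) => [i|]; first exact: measurableI.
apply/seteqP; split=> w /=; first by move=> [w1 w2] i; split.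
by move=> w12; split=> i; have [] := w12 i.
Qed.

Lemma measurable_tuple_boxes d (E : measurableType d) n :
  @measurable _ (n.-tuple E) = <<s tuple_boxes E n >>.
Proof.
apply/seteqP; split.
  apply: smallest_sub; first exact: smallest_sigma_algebra.
  apply: (big_ind (fun S => S `<=` <<s tuple_boxes E n >>)) => //.
  - by move=> S1 S2 h1 h2; rewrite subUset.
  - move=> i _ _ [A mA <-]; apply: sub_sigma_algebra.
    exists (fun j => if j == i then A else setT) => [j|]; first by case: ifP.
    apply/seteqP; split=> x /=.
      by move=> [_ Ax] j; case: eqP => // ->.
    by move=> /(_ i); rewrite eqxx.
apply: smallest_sub; first exact: sigma_algebra_measurable.
move=> _ [C mC ->].
rewrite (_ : mkset _ = \bigcap_(i in [set: 'I_n]) ((@tnth n E)^~ i @^-1` C i)).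
  apply: fin_bigcap_measurable => // i _.
  by rewrite -[_ @^-1` _]setTI; apply: measurable_tnth.
by apply/seteqP; split=> [x H i _|x H i]; exact: H.
Qed.

Lemma sigma_family_finbox (T : pointedType) d (E : measurableType d)
    (V : nat -> T -> E) (D : set nat) n (t : 'I_n -> nat) (Q : pred 'I_n)
    (C : 'I_n -> set E) :
  (forall i, measurable (C i)) -> (forall i, Q i -> D (t i)) ->
  sigma_family V D [set x | forall i, Q i -> C i (V (t i) x)].
Proof.
move=> mC QD.
rewrite (_ : mkset _ = \bigcap_(i in [set i | Q i]) (V (t i) @^-1` C i)).
  apply: (@fin_bigcap_measurable _ (g_sigma_algebraType _)) => // i Qi.
  apply: sub_sigma_algebra; exists (t i); first exact: QD.
  by exists (C i) => //; rewrite setTI.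
by apply/seteqP; split.
Qed.

Section swap.
Context d d' (Om : measurableType d) (E : measurableType d') (R : realType).
Variables (P : probability Om R) (Y Y' : nat -> Om -> E).
Hypothesis mY : forall i, measurable_fun setT (Y i).
Hypothesis mY' : forall i, measurable_fun setT (Y' i).
Hypothesis indY : mutually_independent P [set: nat] Y.
Hypothesis copyY : independent_copy P Y Y'.
Variable D : pred nat.
Let Ds : set nat := [set i | D i].

Definition mix (i : nat) : Om -> E := if D i then Y i else Y' i.

Lemma measurable_mix i : measurable_fun setT (mix i).
Proof. by rewrite /mix; case: ifP. Qed.

(** The constraints on the mixed sequence split into constraints on Y over D and
    constraints on Y' outside D. The latter are independent of Y and have the
    same probability as the corresponding constraints on Y, which are themselves
    independent of the events over D; A2 factors out on both sides. *)
Lemma mix_law n (t : 'I_n -> nat) (C : 'I_n -> set E) (A1 A2 : set Om) :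
  (forall i, measurable (C i)) ->
  sigma_family Y Ds A1 -> sigma_family Y (~` Ds) A2 ->
  P (A1 `&` A2 `&` [set w | forall i, C i (mix (t i) w)])
  = (P A2 * P (A1 `&` [set w | forall i, C i (Y (t i) w)]))%E.
Proof.
move=> mC GA1 GA2.
pose Q i := D (t i).
pose K1 := [set w | forall i, Q i -> C i (Y (t i) w)].
pose K2 := [set w | forall i, ~~ Q i -> C i (Y (t i) w)].
pose K2' := [set w | forall i, ~~ Q i -> C i (Y' (t i) w)].
have GK1 : sigma_family Y Ds K1 by exact: sigma_family_finbox.
have GK2 : sigma_family Y (~` Ds) K2.
  by apply: sigma_family_finbox => // i /negP.
have GK2' : sigma_family Y' setT K2' by exact: sigma_family_finbox.
have lawK : P K2' = P K2.
  apply: (copyY.2 [set x | forall i, ~~ Q i -> C i (x (t i))]).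
  exact: (@sigma_family_finbox _ _ _ (fun k (x : nat -> E) => x k)).
have dD : Ds `&` ~` Ds = set0 by rewrite setICr.
have GA1K1 := sigma_family_setI GA1 GK1.
rewrite (_ : _ `&` _ `&` _ = (A1 `&` K1) `&` A2 `&` K2'); last first.
  apply/seteqP; split=> w /= [[]].
    move=> a1 a2 H; split; first split=> //; first split=> //.
      by move=> i Qi; have := H i; rewrite /mix -/(Q i) Qi.
    by move=> i Qi; have := H i; rewrite /mix -/(Q i) (negbTE Qi).
  move=> [a1 k1] a2 k2; split=> // i; rewrite /mix -/(Q i).
  by case: ifPn; [exact: k1|exact: k2].
rewrite (_ : A1 `&` [set _ | _] = (A1 `&` K1) `&` K2); last first.
  apply/seteqP; split=> w /=; first by move=> [a1 H]; split; [split|] => // i _.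
  move=> [[a1 k1] k2]; split=> // i.
  by case: (boolP (Q i)); [exact: k1|exact: k2].
rewrite (copyY.1 _ _ _ GK2'); last first.
  apply: sigma_family_setI.
    by apply: sigma_family_mono GA1K1.
  by apply: sigma_family_mono GA2.
rewrite lawK (independent_blocks mY indY dD GA1K1 GA2).
rewrite (independent_blocks mY indY dD GA1K1 GK2).
by rewrite muleAC muleC muleA.
Qed.

(** A pi-system generating the sigma-algebra of the whole sequence Y. *)
Let blocks : set (set Om) := [set A | exists A1 A2,
  [/\ sigma_family Y Ds A1, sigma_family Y (~` Ds) A2 & A = A1 `&` A2]].

Let blocks_setT : blocks setT.
Proof.
by exists setT, setT; split; [exact: sigma_family_setT..|rewrite setTI].
Qed.

Let blocks_setI : setI_closed blocks.
Proof.
move=> _ _ [A1 [A2 [GA1 GA2 ->]]] [B1 [B2 [GB1 GB2 ->]]].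
exists (A1 `&` B1), (A2 `&` B2); split; [exact: sigma_family_setI..|].
by rewrite setIACA.
Qed.

Let sigma_blocks : sigma_family Y setT `<=` <<s blocks >>.
Proof.
apply: sigma_family_sub => i _ A mA; apply: sub_sigma_algebra.
have [Di|nDi] := boolP (D i).
  exists (Y i @^-1` A), setT; rewrite setIT; split=> //.
    exact: sigma_family_gen.
  exact: sigma_family_setT.
exists setT, (Y i @^-1` A); rewrite setTI; split=> //.
  exact: sigma_family_setT.
by apply: sigma_family_gen => //; exact/negP.
Qed.

(** Conditioning the mixed variable X' on all of Y is the same as conditioning X
    on the Y_i with i in D. For A = A1 `&` A2 with A1 over D and A2 over the
    complement, both the integral of Z over A and that of X' over A are P A2
    times the corresponding integral over A1: the former because Z and A1 depend
    on D only, the latter by [mix_law]. *)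
Lemma condexp_mix n (t : 'I_n -> nat) (f : n.-tuple E -> R) (Z : Om -> R) :
  let X w := f [tuple Y (t i) w | i < n] in
  let X' w := f [tuple mix (t i) w | i < n] in
  measurable_fun setT f -> X \in Lfun P 1%E ->
  is_condexp P (sigma_family Y Ds) X Z ->
  X' \in Lfun P 1%E /\ is_condexp P (sigma_family Y setT) X' Z.
Proof.
move=> X X' mf iX [mZ iZ EZ].
pose tY w := [tuple Y (t i) w | i < n].
pose tM w := [tuple mix (t i) w | i < n].
have mtY : measurable_fun setT tY.
  apply/measurable_fun_tnthP => i.
  rewrite (_ : _ \o _ = Y (t i))//.
  by apply/funext => w; rewrite /= tnth_mktuple.
have mtM : measurable_fun setT tM.
  apply/measurable_fun_tnthP => i.
  rewrite (_ : _ \o _ = mix (t i)); first exact: measurable_mix.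
  by apply/funext => w; rewrite /= tnth_mktuple.
have boxE (V : nat -> Om -> E) (C : 'I_n -> set E) :
    (fun w => [tuple V (t i) w | i < n])
      @^-1` [set x | forall i, C i (tnth x i)]
    = [set w | forall i, C i (V (t i) w)].
  by apply/seteqP; split=> w /= H i; have := H i; rewrite tnth_mktuple.
have mG D' : sigma_family Y D' `<=` measurable.
  exact: sigma_family_measurable.
have iX' : X' \in Lfun P 1%E.
  have mEf : measurable_fun setT (EFin \o f) by exact/measurable_EFinP.
  apply/Lfun1_integrable/integrableP; split.
    by apply/measurable_EFinP; exact: measurableT_comp.
  have PT0 : 0 <= 1 :> R by [].
  have := @ge0_integral_law_restr _ _ _ _ _ P tM tY setT setT (NngNum PT0)
    (tuple_boxes E n) mtM mtY measurableT measurableT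
    (measurable_tuple_boxes _ _) (@tuple_boxes_setI _ _ _)
    (@tuple_boxes_setT _ _ _) _ (abse \o (EFin \o f)) _ _.
  rewrite mul1e => -> //.
  - by case/Lfun1_integrable/integrableP : iX.
  - move=> _ [C mC ->]; rewrite !boxE -{1}(setIT setT) mix_law//.
    + by rewrite probability_setT.
    + exact: sigma_family_setT.
    + exact: sigma_family_setT.
  - exact: measurableT_comp.
  - by move=> x; exact: abse_ge0.
split=> //; split=> //.
  move=> B mB; apply: sigma_family_mono (mZ B mB); exact: subsetT.
move=> A /sigma_blocks; apply: (eq_integral_pi_system blocks_setI) => //.
- move=> _ [A1 [A2 [GA1 GA2 ->]]].
  by apply: measurableI; [exact: (mG _ _ GA1)|exact: (mG _ _ GA2)].
- exact/Lfun1_integrable.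
- exact/Lfun1_integrable.
- move=> _ [A1 [A2 [GA1 GA2 ->]]].
  have PA20 : 0 <= fine (P A2) by rewrite fine_ge0.
  have cE : (fine (P A2))%:E = P A2.
    by rewrite fineK// fin_num_measure//; exact: (mG _ _ GA2).
  have mA1 := mG _ _ GA1; have mA2 := mG _ _ GA2.
  have mA12 := measurableI _ _ mA1 mA2.
  have mfZ := Lfun1_measurable iZ.
  rewrite [RHS](@integral_law_restr _ _ _ _ _ P tM tY (A1 `&` A2) A1
    (NngNum PA20) (tuple_boxes E n) mtM mtY _ _
    (measurable_tuple_boxes _ _) (@tuple_boxes_setI _ _ _)
    (@tuple_boxes_setT _ _ _) _ (EFin \o f) _ _)//; last 3 first.
  + by move=> _ [C mC ->]; rewrite !boxE mix_law//= cE.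
  + exact/measurable_EFinP.
  + exact: L1_integrableS.
  rewrite [LHS](@integral_law_restr _ _ _ _ _ P Z Z (A1 `&` A2) A1
    (NngNum PA20) measurable _ _ _ _ _ _ _ _ EFin _ _)//.
  + by rewrite EZ.
  + by rewrite sigma_algebra_id//; exact: sigma_algebra_measurable.
  + by move=> ? ? ? ?; exact: measurableI.
  + move=> C mC; rewrite /= cE muleC setIAC.
    apply: (independent_blocks mY indY _ _ GA2); first exact: setICr.
    by apply: sigma_family_setI => //; exact: mZ.
  + exact: L1_integrableS.
Qed.

End swap.

(** * Dyadic chaining of partial sums *)

Section dyadic.
Variable R : realFieldType.

Lemma bigmax_nat_le (N : nat) (F : nat -> R) (c : R) : 0 <= c ->
  (forall n, (1 <= n <= N)%N -> F n <= c) ->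
  \big[Num.max/0]_(1 <= n < N.+1) F n <= c.
Proof.
move=> c0 H; rewrite big_seq; apply: bigmax_le => // i.
by rewrite mem_index_iota ltnS; exact: H.
Qed.

Lemma le_bigmax_nat1 (N n : nat) (F : nat -> R) : (1 <= n <= N)%N ->
  F n <= \big[Num.max/0]_(1 <= n < N.+1) F n.
Proof.
by move=> nN; apply: (le_bigmax_seq 0 n); rewrite // mem_index_iota ltnS.
Qed.

Lemma bigmax_nat_ge0 (N : nat) (F : nat -> R) :
  0 <= \big[Num.max/0]_(1 <= n < N.+1) F n.
Proof. exact: bigmax_ge_id. Qed.

(** For n odd the last term remains unpaired. *)
Lemma sum_pairs (a : nat -> R) (n : nat) :
  \sum_(1 <= i < n.+1) a i =
  \sum_(1 <= l < n./2.+1) (a (2 * l - 1)%N + a (2 * l)%N)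
  + (if odd n then a n else 0).
Proof.
have E m : \sum_(1 <= i < (m.*2).+1) a i =
    \sum_(1 <= l < m.+1) (a (2 * l - 1)%N + a (2 * l)%N).
  elim: m => [|m IH]; first by rewrite !big_geq.
  rewrite doubleS big_nat_recr//= big_nat_recr//= IH [in RHS]big_nat_recr//=.
  rewrite -addrA; congr (_ + (a _ + a _)); lia.
have := odd_double_half n; case: (odd n) => /= nE.
  rewrite -{1}nE add1n big_nat_recr//= E; congr (_ + a _); lia.
by rewrite -{1}nE add0n E addr0.
Qed.

Variables (x : nat -> R) (u t : nat -> nat -> R).
Hypothesis xE : forall l, (1 <= l)%N -> x l = t 0%N l + u 0%N l.
Hypothesis uE : forall k l, (1 <= l)%N ->
  u k (2 * l - 1)%N + u k (2 * l)%N = t k.+1 l + u k.+1 l.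

Let U k N : R := \big[Num.max/0]_(1 <= l < N.+1) `|u k l|.
Let V k N : R := \big[Num.max/0]_(1 <= m < N.+1) `|\sum_(1 <= l < m.+1) t k l|.

Lemma le_sum_max (k N m : nat) (m0 : (m <= N)%N) :
  `|\sum_(1 <= l < m.+1) t k l| <= V k N.
Proof.
case: m m0 => [|m] mN; last exact: le_bigmax_nat1.
by rewrite big_geq// normr0 bigmax_nat_ge0.
Qed.

(** By induction on the number of levels left: the pairs of u k are rewritten
    with [uE] and the unpaired term is bounded by U. *)
Lemma max_sum_dyadic (k d n : nat) : (n <= 2 ^ d)%N ->
  `|\sum_(1 <= i < n.+1) u k i| <=
  \sum_(0 <= i < d.+1) U (k + i) (2 ^ (d - i)) +
  \sum_(0 <= i < d) V (k + i).+1 (2 ^ (d - i.+1)).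
Proof.
elim: d k n => [|d IH] k n.
  rewrite expn0 big_nat1 [X in _ <= _ + X]big_geq// addr0 addn0.
  case: n => [|[|//]] _; first by rewrite big_geq// normr0 bigmax_nat_ge0.
  by rewrite big_nat1; exact: (@le_bigmax_nat1 1 1 (fun l => `|u k l|)).
move=> nd.
have hd : (n./2 <= 2 ^ d)%N by rewrite expnS in nd; lia.
rewrite sum_pairs big_nat.
under eq_bigr => l /andP[l1 _] do rewrite uE//.
rewrite -big_nat big_split/=.
rewrite [X in _ <= X + _]big_nat_recl// [X in _ <= _ + X]big_nat_recl//.
rewrite !addn0 subn0 subSS subn0.
under [X in _ <= _ + X + _]eq_bigr do rewrite subSS addnS -addSn.
under [X in _ <= _ + (_ + X)]eq_bigr do rewrite subSS addnS -addSn.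
apply: le_trans (ler_normD _ _) _.
apply: le_trans (lerD (ler_normD _ _) (lexx _)) _.
have H1 := le_sum_max k.+1 hd.
have H2 := IH k.+1 _ hd.
have H3 : `|if odd n then u k n else 0| <= U k (2 ^ d.+1).
  case: ifPn => on; last by rewrite normr0 bigmax_nat_ge0.
  by apply: (@le_bigmax_nat1 _ n (fun l => `|u k l|)); rewrite nd andbT odd_gt0.
apply: le_trans (lerD (lerD H1 H2) H3) _.
by rewrite le_eqVlt; apply/orP; left; apply/eqP; ring.
Qed.

Lemma max_partial_sums_dyadic (d : nat) :
  \big[Num.max/0]_(1 <= n < (2 ^ d).+1) `|\sum_(1 <= i < n.+1) x i|
  <= \sum_(0 <= k < d.+1) U k (2 ^ (d - k))
   + \sum_(0 <= k < d.+1) V k (2 ^ (d - k)).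
Proof.
apply: bigmax_nat_le => [|n /andP[n1 nd]].
  by apply: addr_ge0; apply: sumr_ge0 => k _; exact: bigmax_nat_ge0.
rewrite big_nat; under eq_bigr => l /andP[l1 _] do rewrite xE//.
rewrite -big_nat big_split/=; apply: le_trans (ler_normD _ _) _.
rewrite [X in _ <= _ + X]big_nat_recl// subn0.
by rewrite addrCA; apply: lerD; [exact: le_sum_max|exact: max_sum_dyadic].
Qed.

End dyadic.

(** * The remainders U and the differences T *)

Section remainders.
Context (R : realType) (disp : measure_display) (Om : measurableType disp)
  (P : probability Om R) (disp' : measure_display) (E : measurableType disp').
Variables (eta : nat -> {RV P >-> E})
  (f : forall n : nat, {mfun n.+1.-tuple E >-> R}).
Hypothesis X_int : forall n, (1 <= n)%N -> X_ f eta n \in Lfun P 1%E.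

Lemma measurable_eta i : measurable_fun [set: Om] (eta i).
Proof. exact: measurable_funPT. Qed.
Local Hint Resolve measurable_eta : core.

Lemma G_measurable k l : G_ eta k l `<=` measurable.
Proof. exact: sigma_family_measurable. Qed.

Lemma X_sigma_family n B : measurable B ->
  sigma_family eta setT (X_ f eta n @^-1` B).
Proof.
move: B; apply/measurable_g_sigmaP; rewrite /X_.
apply: (measurableT_comp (measurable_funPT (f n))).
apply/measurable_fun_tnthP => i.
rewrite (_ : _ \o _ = eta (n - i)%N); last first.
  by apply/funext => w; rewrite /= tnth_mktuple.
by apply/measurable_g_sigmaP => B mB; exact: sigma_family_gen.
Qed.

Lemma condexp_X n : (1 <= n)%N ->
  is_condexp P (sigma_family eta setT) (X_ f eta n) (X_ f eta n).
Proof.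
by move=> n1; apply: condexp_id; [exact: X_sigma_family|exact: X_int].
Qed.

Lemma dyadic_window k l i : (1 <= l)%N ->
  (l * 2 ^ k - (2 ^ k - 1) <= i <= l * 2 ^ k)%N =
  (l.-1 * 2 ^ k + 1 <= i <= l * 2 ^ k)%N.
Proof.
case: l => // l _; have := expn_gt0 2 k; rewrite mulSn /= => p0.
by congr (_ && _); congr (_ <= _)%N; lia.
Qed.

Variables (EX : nat -> nat -> nat -> Om -> R).
Hypothesis EXE : forall k l j, (1 <= l)%N ->
  (l.-1 * 2 ^ k + 1 <= j <= l * 2 ^ k)%N ->
  is_condexp P (G_ eta (l * 2 ^ k) (2 ^ k - 1)) (X_ f eta j) (EX k l j).

Lemma EX_L1 k l j : (1 <= l)%N -> (l.-1 * 2 ^ k + 1 <= j <= l * 2 ^ k)%N ->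
  EX k l j \in Lfun P 1%E.
Proof. by move=> l1 jb; have [] := EXE l1 jb. Qed.

Lemma block_ge1 (k l j : nat) : (l.-1 * 2 ^ k + 1 <= j <= l * 2 ^ k)%N ->
  (1 <= j)%N.
Proof. by move=> /andP[+ _]; apply: leq_trans; rewrite addn1. Qed.

Lemma U_L1 k l : (1 <= l)%N -> U_ f eta EX k l \in Lfun P 1%E.
Proof.
move=> l1; rewrite /U_.
apply: (@Lfun1_sum _ _ _ P (fun j w => X_ f eta j w - EX k l j w)) => j.
rewrite mem_index_iota ltnS => jb.
apply: rpredB; [exact: X_int (block_ge1 jb)|exact: EX_L1].
Qed.

Section innovation_bound.
Hypothesis eta_indep : mutually_independent P [set: nat] eta.
Variable eta' : nat -> {RV P >-> E}.
Hypothesis copy : independent_copy P eta eta'.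

(** X_j minus its conditional expectation given the block of j is a conditional
    expectation of X_j - X'_{j,m} given the whole sequence, where m + 1 is the
    rank of j in its block. *)
Lemma Lnorm_innovation_le (q : R) k l j : 1 <= q -> (1 <= l)%N ->
  (l.-1 * 2 ^ k + 1 <= j <= l * 2 ^ k)%N ->
  ('N[P]_q%:E[EFin \o (X_ f eta j \- EX k l j)%R]
   <= delta_star P f eta eta' q (j - l.-1 * 2 ^ k))%E.
Proof.
move=> q1 l1 jb; have j1 := block_ge1 jb.
pose m := (j - l.-1 * 2 ^ k - 1)%N.
have mE : (j - l.-1 * 2 ^ k = m.+1)%N.
  by rewrite /m; move/andP: jb => [b1 b2]; lia.
pose D (i : nat) := (l * 2 ^ k - (2 ^ k - 1) <= i <= l * 2 ^ k)%N.
have mj : (m + 1 <= j)%N by rewrite /m; move/andP: jb => [b1 b2]; lia.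
have measurable_eta' i : measurable_fun [set: Om] (eta' i).
  exact: measurable_funPT.
have [iX' cX'] := @condexp_mix _ _ _ _ _ P eta eta' measurable_eta
  measurable_eta' eta_indep copy D j.+1 (fun i => (j - i)%N) (f j) (EX k l j)
  (measurable_funPT (f j)) (X_int j1) (EXE l1 jb).
have XE : (fun w => f j [tuple mix eta eta' D (j - i)%N w | i < j.+1])
          = X'_ f eta eta' j m.
  apply/funext => w; congr (f j _); apply: eq_from_tnth => i.
  rewrite !tnth_mktuple /mix /D dyadic_window//.
  have ij : (i <= j)%N by rewrite -ltnS.
  have -> : (l.-1 * 2 ^ k + 1 <= j - i <= l * 2 ^ k)%N = (i <= m)%N.
    by rewrite /m; move/andP: jb => [b1 b2]; apply/idP/idP; lia.
  by case: ifP.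
rewrite XE in iX' cX'.
rewrite mE /=.
have mG : sigma_family eta setT `<=` measurable.
  exact: sigma_family_measurable.
have H := condexpB mG (X_int j1) iX' (condexp_X j1) cX'.
have iXX' : X_ f eta j \- X'_ f eta eta' j m \in Lfun P 1%E.
  by apply: rpredB => //; exact: X_int.
apply: (le_trans (Lnorm_condexp_le mG q1 iXX' H)).
apply: (@le_trans _ _ (ereal_sup
  [set ('N[P]_q%:E[EFin \o (X_ f eta k' \- X'_ f eta eta' k' m)%R])%E
  | k' in [set k' | (m + 1 <= k')%N]])).
  by apply: ereal_sup_ubound; exists j.
by apply: ereal_sup_ubound; exists m => /=.
Qed.

Lemma Lnorm_U_le (q : R) k l : 1 <= q -> (1 <= l)%N ->
  ('N[P]_q%:E[EFin \o U_ f eta EX k l]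
   <= \sum_(1 <= j < (2 ^ k).+1) delta_star P f eta eta' q j)%E.
Proof.
move=> q1 l1.
have mF j : j \in index_iota (l.-1 * 2 ^ k + 1) (l * 2 ^ k).+1 ->
    measurable_fun [set: Om] (X_ f eta j \- EX k l j).
  rewrite mem_index_iota ltnS => jb.
  apply: (Lfun1_measurable (P := P)).
  by apply: Lfun1B; [exact: X_int (block_ge1 jb)|exact: EX_L1].
have H := Lnorm_sum_le P mF q1. apply: (le_trans H).
apply: (@le_trans _ _ (\sum_(l.-1 * 2 ^ k + 1 <= j < (l * 2 ^ k).+1)
    delta_star P f eta eta' q (j - l.-1 * 2 ^ k))%E).
  rewrite big_nat [leRHS]big_nat; apply: lee_sum => j.
  by rewrite ltnS => jb; exact: Lnorm_innovation_le.
rewrite addnC big_addn.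
rewrite (_ : (_ - _)%N = (2 ^ k).+1); last first.
  by case: (l) l1 => // l' _; rewrite mulSn /=; lia.
by under eq_bigr do rewrite addnK.
Qed.

End innovation_bound.
End remainders.

Section level_differences.
Context (R : realType) (disp : measure_display) (Om : measurableType disp)
  (P : probability Om R) (disp' : measure_display) (E : measurableType disp').
Variables (eta : nat -> {RV P >-> E})
  (f : forall n : nat, {mfun n.+1.-tuple E >-> R}).
Hypothesis eta_indep : mutually_independent P [set: nat] eta.
Hypothesis X_int : forall n, (1 <= n)%N -> X_ f eta n \in Lfun P 1%E.
Hypothesis X_centered : forall n, (1 <= n)%N -> ('E_P[X_ f eta n] = 0)%E.
Variables (EX : nat -> nat -> nat -> Om -> R).
Hypothesis EXE : forall k l j, (1 <= l)%N ->
  (l.-1 * 2 ^ k + 1 <= j <= l * 2 ^ k)%N ->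
  is_condexp P (G_ eta (l * 2 ^ k) (2 ^ k - 1)) (X_ f eta j) (EX k l j).
Variable T : nat -> nat -> Om -> R.
Hypothesis T0E : forall l, (1 <= l)%N ->
  is_condexp P (G_ eta l 0) (X_ f eta l) (T 0%N l).
Hypothesis TSE : forall k l, (1 <= l)%N ->
  is_condexp P (G_ eta (l * 2 ^ k.+1) (2 ^ k.+1 - 1))
    (fun w => U_ f eta EX k (2 * l - 1) w + U_ f eta EX k (2 * l) w)
    (T k.+1 l).

Let mGk k l : G_ eta k l `<=` measurable := @G_measurable _ _ _ _ _ _ eta k l.
Arguments mGk : clear implicits.

Lemma U0E l w : (1 <= l)%N -> U_ f eta EX 0 l w = X_ f eta l w - EX 0 l l w.
Proof.
by case: l => // l _; rewrite /U_ expn0 !muln1 addn1 big_nat1.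
Qed.

Lemma ae_T0 l : (1 <= l)%N ->
  {ae P, forall w, X_ f eta l w = T 0%N l w + U_ f eta EX 0 l w}.
Proof.
move=> l1; have cT := T0E l1.
have lb : (l.-1 * 2 ^ 0 + 1 <= l <= l * 2 ^ 0)%N.
  by case: l l1 {cT} => // l _; lia.
have cX := EXE l1 lb; rewrite expn0 muln1 in cX.
have := condexp_ae_unique (mGk _ _) (X_int l1) cT cX.
by apply: filterS => w e; rewrite U0E// e; ring.
Qed.

(** A block of level k + 1 consists of two consecutive blocks of level k. *)
Lemma block_split k l : (1 <= l)%N ->
  forall F : nat -> R,
  \sum_(l.-1 * 2 ^ k.+1 + 1 <= j < (l * 2 ^ k.+1).+1) F j =
  \sum_((2 * l - 1).-1 * 2 ^ k + 1 <= j < ((2 * l - 1) * 2 ^ k).+1) F j +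
  \sum_((2 * l).-1 * 2 ^ k + 1 <= j < (2 * l * 2 ^ k).+1) F j.
Proof.
case: l => // l _ F; have p0 : (0 < 2 ^ k)%N by rewrite expn_gt0.
rewrite (@big_cat_nat _ _ _ ((2 * l.+1 - 1) * 2 ^ k).+1) /=; last 2 first.
- by rewrite expnS; lia.
- by rewrite expnS; lia.
by congr (_ + _); apply: congr_big_nat => //; rewrite ?expnS; lia.
Qed.

Lemma half_block_window k l h i : (1 <= l)%N -> h \in [:: 2 * l - 1; 2 * l]%N ->
  (h * 2 ^ k - (2 ^ k - 1) <= i <= h * 2 ^ k)%N ->
  (l * 2 ^ k.+1 - (2 ^ k.+1 - 1) <= i <= l * 2 ^ k.+1)%N.
Proof.
case: l => // l _; rewrite !inE => hE.
have p0 : (0 < 2 ^ k)%N by rewrite expn_gt0.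
have h1 : (1 <= h)%N by case/orP: hE => /eqP->; lia.
rewrite !dyadic_window//.
have := expnS 2 k; move: p0; set p := (2 ^ k)%N; set q := (2 ^ k.+1)%N => p0 qE.
case/orP: hE => /eqP-> /andP[a b]; apply/andP; split; nia.
Qed.

Lemma half_block_sub k l h : (1 <= l)%N -> h \in [:: 2 * l - 1; 2 * l]%N ->
  G_ eta (h * 2 ^ k) (2 ^ k - 1) `<=` G_ eta (l * 2 ^ k.+1) (2 ^ k.+1 - 1).
Proof.
by move=> l1 hl; apply: sigma_family_mono => i; exact: half_block_window.
Qed.

Lemma half_block_ge1 l h : (1 <= l)%N -> h \in [:: 2 * l - 1; 2 * l]%N ->
  (1 <= h)%N.
Proof. by move=> l1; rewrite !inE => /orP[] /eqP->; lia. Qed.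

(** Both T_{k+1,l} and the sum of the EX_{k+1,l,j} minus the EX of the two half
    blocks are conditional expectations, given the block of level k + 1, of
    U_{k,2l-1} + U_{k,2l}: the half blocks generate smaller sigma-algebras, so
    that their EX are left unchanged. *)
Lemma ae_TS k l : (1 <= l)%N ->
  {ae P, forall w, U_ f eta EX k (2 * l - 1) w + U_ f eta EX k (2 * l) w
                   = T k.+1 l w + U_ f eta EX k.+1 l w}.
Proof.
move=> l1.
set G := G_ eta (l * 2 ^ k.+1) (2 ^ k.+1 - 1).
pose blk h := index_iota (h.-1 * 2 ^ k + 1) (h * 2 ^ k).+1.
pose big := index_iota (l.-1 * 2 ^ k.+1 + 1) (l * 2 ^ k.+1).+1.
have mG : G `<=` measurable := mGk _ _.
have cb : is_condexp P G (fun w => \sum_(j <- big) X_ f eta j w)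
                         (fun w => \sum_(j <- big) EX k.+1 l j w).
  apply: condexp_sum => // j; rewrite mem_index_iota ltnS => jb.
    exact: X_int (block_ge1 jb).
  exact: EXE.
have ih h : h \in [:: 2 * l - 1; 2 * l]%N -> forall j, j \in blk h ->
    is_condexp P G (EX k h j) (EX k h j).
  move=> hl j; rewrite mem_index_iota ltnS => jb.
  have [mE iE _] := EXE (half_block_ge1 l1 hl) jb.
  by apply: condexp_id => // B mB; apply: half_block_sub hl _ (mE B mB).
have cs h : h \in [:: 2 * l - 1; 2 * l]%N ->
    is_condexp P G (fun w => \sum_(j <- blk h) EX k h j w)
                   (fun w => \sum_(j <- blk h) EX k h j w).
  move=> hl; apply: condexp_sum => // j /(ih h hl) //.
  by case.
have h1 : (2 * l - 1)%N \in [:: 2 * l - 1; 2 * l]%N by rewrite mem_head.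
have h2 : (2 * l)%N \in [:: 2 * l - 1; 2 * l]%N by rewrite !inE eqxx orbT.
have iX : (fun w => \sum_(j <- big) X_ f eta j w) \in Lfun P 1%E.
  apply: Lfun1_sum => j; rewrite mem_index_iota ltnS => jb.
  exact: X_int (block_ge1 jb).
have i1 := condexp_L1 (cs _ h1); have i2 := condexp_L1 (cs _ h2).
have cX1 := condexpB mG iX i1 cb (cs _ h1).
have iX1 : (fun w => \sum_(j <- big) X_ f eta j w) \-
           (fun w => \sum_(j <- blk (2 * l - 1)%N) EX k (2 * l - 1) j w)
           \in Lfun P 1%E by exact: rpredB.
have c12 := condexpB mG iX1 i2 cX1 (cs _ h2).
have UE w : U_ f eta EX k (2 * l - 1) w + U_ f eta EX k (2 * l) w =
    \sum_(j <- big) X_ f eta j w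
    - \sum_(j <- blk (2 * l - 1)%N) EX k (2 * l - 1) j w
    - \sum_(j <- blk (2 * l)%N) EX k (2 * l) j w.
  by rewrite /U_ /big (block_split k l1) !sumrB; rewrite /blk; ring.
have iX2 := Lfun1B iX1 i2.
have cT := TSE k l1; rewrite (funext UE) in cT.
have := condexp_ae_unique mG iX2 cT c12.
apply: filterS => w -> /=; rewrite UE.
by rewrite [U_ f eta EX k.+1 l w]/U_ -/big sumrB; ring.
Qed.

Lemma max_S_le (d : nat) : {ae P, forall w,
  \big[Num.max/0]_(1 <= n < (2 ^ d).+1) `|S_ f eta n w|
  <= \sum_(0 <= k < d.+1)
       \big[Num.max/0]_(1 <= l < (2 ^ (d - k)).+1) `|U_ f eta EX k l w|
   + \sum_(0 <= k < d.+1)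
       \big[Num.max/0]_(1 <= m < (2 ^ (d - k)).+1)
          `|\sum_(1 <= l < m.+1) T k l w| }.
Proof.
have h0 : {ae P, forall w l, (1 <= l)%N ->
    X_ f eta l w = T 0%N l w + U_ f eta EX 0 l w}.
  apply/ae_foralln => l; have [->|l0] := posnP l; first by apply: nearW.
  by apply: filterS (ae_T0 l0).
have hS : {ae P, forall w k l, (1 <= l)%N ->
    U_ f eta EX k (2 * l - 1) w + U_ f eta EX k (2 * l) w
    = T k.+1 l w + U_ f eta EX k.+1 l w}.
  apply/ae_foralln => k; apply/ae_foralln => l.
  have [->|l0] := posnP l; first by apply: nearW.
  by apply: filterS (ae_TS k l0).
apply: filterS2 h0 hS => w h0 hS.
exact: (@max_partial_sums_dyadic _ (fun i => X_ f eta i w)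
  (fun k l => U_ f eta EX k l w) (fun k l => T k l w)).
Qed.

Lemma integral_U k l : (1 <= l)%N ->
  (\int[P]_w (U_ f eta EX k l w)%:E = 0)%E.
Proof.
move=> l1.
pose blk := index_iota (l.-1 * 2 ^ k + 1) (l * 2 ^ k).+1.
have ib j : j \in blk -> (l.-1 * 2 ^ k + 1 <= j <= l * 2 ^ k)%N.
  by rewrite mem_index_iota ltnS.
have iX : (fun w => \sum_(j <- blk) X_ f eta j w) \in Lfun P 1%E.
  by apply: Lfun1_sum => j /ib jb; exact: X_int (block_ge1 jb).
have c : is_condexp P (G_ eta (l * 2 ^ k) (2 ^ k - 1))
    (fun w => \sum_(j <- blk) X_ f eta j w)
    (fun w => \sum_(j <- blk) EX k l j w).
  apply: condexp_sum => [|j /ib jb|j /ib jb].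
  - exact: mGk.
  - exact: X_int (block_ge1 jb).
  - exact: EXE.
have [_ iE /(_ [set: Om]) EE] := c.
have {}EE := EE (@sigma_algebra_setT _ _).
rewrite (_ : (fun w => _) = (fun w => (\sum_(j <- blk) X_ f eta j w)%:E -
    (\sum_(j <- blk) EX k l j w)%:E)%E); last first.
  by apply/funext => w; rewrite /U_ sumrB EFinB.
rewrite integralB_EFin//; [|exact: L1_integrableS..].
rewrite EE subee//; apply: integrable_fin_num => //.
exact: (L1_integrableS iX measurableT).
Qed.

(** Treats the levels 0 and k + 1 uniformly. *)
Lemma T_condexp k l : (1 <= l)%N -> exists W : Om -> R,
  [/\ W \in Lfun P 1%E,
      is_condexp P (G_ eta (l * 2 ^ k) (2 ^ k - 1)) W (T k l)
    & (\int[P]_w (W w)%:E = 0)%E].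
Proof.
move=> l1; case: k => [|k].
  exists (X_ f eta l); split; first exact: X_int.
    by rewrite expn0 muln1; exact: T0E.
  by have := X_centered l1; rewrite unlock.
exists (fun w => U_ f eta EX k (2 * l - 1) w + U_ f eta EX k (2 * l) w).
have i1 : U_ f eta EX k (2 * l - 1) \in Lfun P 1%E by apply: U_L1 => //; lia.
have i2 : U_ f eta EX k (2 * l) \in Lfun P 1%E by apply: U_L1 => //; lia.
split; [exact: rpredD|exact: TSE|].
rewrite (integralD_EFin measurableT); [|exact: L1_integrableS..].
by rewrite !integral_U ?adde0//; lia.
Qed.

Lemma T_L1 k l : (1 <= l)%N -> T k l \in Lfun P 1%E.
Proof. by move=> /(T_condexp k)[W [_ /condexp_L1]]. Qed.

Lemma expectation_T k l : (1 <= l)%N -> ('E_P[T k l] = 0)%E.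
Proof.
move=> /(T_condexp k)[W [_ [_ _ E0] W0]].
by rewrite unlock E0//; exact: sigma_algebra_setT.
Qed.

Lemma T_independent k (K : set nat) : K `<=` [set l | (1 <= l)%N] ->
  mutually_independent P K (T k).
Proof.
move=> K1.
apply: (@mutually_independent_blocks _ _ _ _ _ P eta _ eta_indep _ _ K
  (fun l => [set i : nat | (l * 2 ^ k - (2 ^ k - 1) <= i <= l * 2 ^ k)%N])).
- by move=> i; exact: measurable_eta.
- move=> i j /K1 /= i1 /K1 /= j1 ij; apply/seteqP; split=> // x /=.
  rewrite !dyadic_window// => -[/andP[a b] /andP[a' b']].
  have : (i.-1 < j)%N /\ (j.-1 < i)%N.
    by split; rewrite -(@ltn_pmul2r (2 ^ k)) ?expn_gt0//; lia.
  by move=> [c c']; move/eqP: ij; apply; lia.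
- by move=> i /K1 i1 A mA; have [W [_ [+ _ _] _]] := T_condexp k i1; exact.
Qed.

Section norm_bounds.
Variable eta' : nat -> {RV P >-> E}.
Hypothesis copy : independent_copy P eta eta'.

Lemma Lnorm_T0_le (q : R) l : 1 <= q -> (1 <= l)%N ->
  ('N[P]_q%:E[EFin \o T 0 l] <= delta_star P f eta eta' q 0)%E.
Proof.
move=> q1 l1.
apply: (le_trans (Lnorm_condexp_le (mGk _ _) q1 (X_int l1) (T0E l1))).
by apply: ereal_sup_ubound; exists l.
Qed.

Lemma Lnorm_TS_le (q : R) k l : 1 <= q -> (1 <= l)%N ->
  ('N[P]_q%:E[EFin \o T k.+1 l] <=
   \sum_(1 <= j < (2 ^ k).+1) delta_star P f eta eta' q j +
   \sum_(1 <= j < (2 ^ k).+1) delta_star P f eta eta' q j)%E.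
Proof.
move=> q1 l1.
have i1 : U_ f eta EX k (2 * l - 1) \in Lfun P 1%E by apply: U_L1 => //; lia.
have i2 : U_ f eta EX k (2 * l) \in Lfun P 1%E by apply: U_L1 => //; lia.
have i12 : U_ f eta EX k (2 * l - 1) \+ U_ f eta EX k (2 * l) \in Lfun P 1%E.
  exact: rpredD.
apply: (le_trans (Lnorm_condexp_le (mGk _ _) q1 i12 (TSE k l1))).
have mU h : (1 <= h)%N -> measurable_fun [set: Om] (U_ f eta EX k h).
  by move=> h1; apply: Lfun1_measurable (U_L1 X_int EXE k h1).
have l2 : (1 <= 2 * l)%N by lia.
have l2' : (1 <= 2 * l - 1)%N by lia.
apply: (le_trans (minkowski_EFin P (mU _ l2') (mU _ l2) q1)).
by apply: leeD; apply: Lnorm_U_le.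
Qed.

End norm_bounds.
End level_differences.

(** * The Rosenthal constant *)

(** Test the inequality on a single fair sign: all its norms are 1. *)
Lemma rosenthal_constant_ge_half (R : realType) (p C : R) : 2 <= p ->
  is_rosenthal_constant p C -> 2^-1 <= C.
Proof.
move=> p2 HC; have p0 : 0 < p by exact: lt_le_trans p2.
have h01 : 0 <= (2^-1 : R) <= 1 by apply/andP; split; lra.
pose B : probability bool R := bernoulli_prob (2^-1 : R).
pose s (b : bool) : R := if b then 1 else -1.
have ms : measurable_fun [set: bool] s by [].
pose xi : {RV B >-> R} := mfun_Sub (mem_set ms).
have xiE b : xi b = s b by [].
have ns b : `|s b| = 1 by rewrite /s; case: b; rewrite ?normrN normr1.
have N1 q : q != 0 -> ('N[B]_q%:E[EFin \o (xi : bool -> R)] = 1)%E.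
  move=> q0; rewrite -Lnorm_abse.
  rewrite (_ : (abse \o _) = cst 1%E); last first.
    by apply/funext => b; congr (_%:E); exact: ns.
  by rewrite Lnorm_cst1 [X in (X `^ _)%E](probability_setT B) poweR1r.
have Lxi : (xi : bool -> R) \in Lfun B p%:E.
  by apply: Lnorm_fin_Lfun; rewrite ?N1 ?ltry ?gt_eqF.
have E0 : ('E_B[xi] = 0)%E.
  rewrite unlock integralE.
  rewrite !integral_bernoulli_prob//=.
  have sT : (fun x : bool => (s x)%:E) true = 1%:E by [].
  have sF : (fun x : bool => (s x)%:E) false = (- 1)%:E by [].
  rewrite !funeposE !funenegE sT sF -!EFinN -!EFin_max -!EFinM -!EFinD.
  rewrite opprK !(max_l ler01) !max_r ?lerN10// /unstable.onem.
  by congr (_%:E); field.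
have indxi : mutually_independent B [set i : nat | (1 <= i <= 1)%N] (fun=> xi).
  move=> J J1 A mA.
  have J1' i : i \in J -> i = 1%N by move=> /J1 /= /andP[? ?]; lia.
  have [J1in|J1n] := boolP (1%N \in J).
    have -> : J = [fset 1%N]%fset.
      by apply/fsetP => i; rewrite inE; apply/idP/eqP => [/J1'|->].
    by rewrite big_seq_fset1 set_fset1 bigcap_set1.
  have -> : J = fset0.
    by apply/fsetP => i; rewrite inE; apply/negP => /[dup] /J1' ->; exact/negP.
  by rewrite big_seq_fset0 set_fset0 bigcap_set0 probability_setT.
have := HC _ _ B 1%N (fun=> xi) isT indxi (fun _ _ => conj Lxi E0).
rewrite big_nat1 big_nat1 !N1 ?gt_eqF// !poweR1r.
rewrite (_ : EFin \o _ = cst 1%E); last first.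
  apply/funext => w /=; congr (_%:E).
  rewrite big_ltn// [X in Num.max _ X]big_geq// big_nat1.
  by rewrite (ns w) max_l.
rewrite Lnorm_cst1 [X in (X `^ _)%E](probability_setT B) poweR1r.
rewrite -EFinD -EFinM lee_fin; lra.
Qed.

Lemma rosenthal_constant_ge (R : realType) (p : R) : 2 <= p ->
  ((2^-1)%:E <= rosenthal_constant p)%E.
Proof.
move=> p2; apply: le_ereal_inf_tmp => _ [C HC <-].
by rewrite lee_fin; exact: rosenthal_constant_ge_half HC.
Qed.

(** The constant may be infinite; the case M = 0 is separate because
    +oo * 0 = 0. *)
Lemma le_rosenthal_constant_mul (R : realType) (p : R) (a M : \bar R) :
  2 <= p -> (0 <= M)%E -> (M = 0 -> a <= 0)%E ->
  (forall C, is_rosenthal_constant p C -> M < +oo -> a <= C%:E * M)%E ->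
  (a <= rosenthal_constant p * M)%E.
Proof.
move=> p2 M0 aM0 aM.
have Cp0 : (0 < rosenthal_constant p)%E.
  by apply: lt_le_trans (rosenthal_constant_ge p2); rewrite lte_fin invr_gt0.
case: M M0 aM0 aM => [m| |]// m0 aM0 aM; last first.
  by rewrite gt0_muley// leey.
have [m00|mp] := eqVneq m 0.
  by rewrite m00 mule0; apply: aM0; rewrite m00.
have {mp m0}m0 : 0 < m by rewrite lt_neqAle eq_sym mp -lee_fin.
rewrite -lee_pdivrMr//; apply: le_ereal_inf_tmp => _ [C HC <-].
by rewrite lee_pdivrMr// aM// ltry.
Qed.

(** If the right-hand side vanishes, every Y i has norm 0, and the maximum is at
    most the sum of the |Y i|. If it is finite, the Y i are in L^p and each
    admissible constant can be used. *)
Lemma rosenthal_maximal (R : realType) (p : R) d (T : measurableType d)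
    (P : probability T R) (n : nat) (Y : nat -> T -> R) : 2 <= p ->
  (1 <= n)%N ->
  (forall i, (1 <= i <= n)%N -> measurable_fun [set: T] (Y i)) ->
  mutually_independent P [set i : nat | (1 <= i <= n)%N] Y ->
  (forall i, (1 <= i <= n)%N -> 'E_P[Y i] = 0)%E ->
  ('N[P]_p%:E[EFin \o (fun w => \big[Num.max/0]_(1 <= m < n.+1)
                             `|\sum_(1 <= i < m.+1) Y i w|)%R]
   <= rosenthal_constant p *
      ((\sum_(1 <= i < n.+1) 'N[P]_2%:E[EFin \o Y i] `^ 2) `^ 2^-1
       + (\sum_(1 <= i < n.+1) 'N[P]_p%:E[EFin \o Y i] `^ p) `^ p^-1))%E.
Proof.
move=> p2 n1 mY indY EY.
have p0 : 0 < p by exact: lt_le_trans p2.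
have p1 : 1 <= p by apply: le_trans p2; rewrite ler1n.
have pV0 : p^-1 != 0 by rewrite invr_eq0 gt_eqF.
pose M2 := ((\sum_(1 <= i < n.+1) 'N[P]_2%:E[EFin \o Y i] `^ 2) `^ 2^-1)%E.
pose Sp := (\sum_(1 <= i < n.+1) 'N[P]_p%:E[EFin \o Y i] `^ p)%E.
have M20 : (0 <= M2)%E by exact: poweR_ge0.
have Sp0 : (0 <= Sp)%E by apply: sume_ge0 => i _; exact: poweR_ge0.
have le_Sp i : (1 <= i <= n)%N -> ('N[P]_p%:E[EFin \o Y i] `^ p <= Sp)%E.
  move=> ib; rewrite /Sp (bigD1_seq i)/= ?iota_uniq ?mem_index_iota//.
  by rewrite leeDl// sume_ge0// => j _; exact: poweR_ge0.
apply: le_rosenthal_constant_mul => //.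
- by rewrite adde_ge0// poweR_ge0.
- move=> M0.
  have Spz : Sp = 0%E.
    have : (Sp `^ p^-1 = 0)%E.
      apply/eqP; rewrite eq_le poweR_ge0 andbT -M0 leeDr//.
    by move=> /poweR_eq0_eq0; exact.
  have NY0 i : (1 <= i <= n)%N -> ('N[P]_p%:E[EFin \o Y i] = 0)%E.
    move=> ib; apply: (@poweR_eq0_eq0 _ _ p); first exact: Lnorm_ge0.
    by apply/eqP; rewrite eq_le poweR_ge0 andbT -Spz le_Sp.
  have mNY i : i \in index_iota 1 n.+1 ->
      measurable_fun [set: T] (fun w => `|Y i w|).
    rewrite mem_index_iota ltnS => ib.
    by apply: measurableT_comp => //; exact: mY.
  have mS : measurable_fun [set: T] (fun w => \sum_(1 <= i < n.+1) `|Y i w|).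
    exact: measurable_sum_seq.
  have := Lnorm_sum_le P mNY p1.
  rewrite [X in (_ <= X)%E](_ : _ = 0%E); last first.
    rewrite big_nat big1// => i ib.
    rewrite -[RHS](NY0 i)// -[RHS]Lnorm_abse//.
  apply: le_trans; apply: le_Lnorm_ae => //.
  + apply: measurable_bigmax => m; rewrite mem_index_iota ltnS => mb.
    apply: measurableT_comp => //; apply: measurable_sum_seq => i.
    by rewrite mem_index_iota ltnS => ib; apply: mY; lia.
  + apply: nearW => w; rewrite ger0_norm ?bigmax_nat_ge0//.
    rewrite ger0_norm ?sumr_ge0//; apply: bigmax_nat_le => [|m mb].
      by rewrite sumr_ge0.
    apply: le_trans (ler_norm_sum _ _ _) _.
    rewrite [leRHS](@big_cat_nat _ _ _ m.+1)//=; last by lia.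
    by rewrite lerDl sumr_ge0.
- move=> C HC Mlty.
  have Splty : (Sp < +oo)%E.
    apply: (@lty_poweRy _ _ p^-1) => //.
    by apply: le_lt_trans Mlty; rewrite leeDr.
  have mZ i : measurable_fun [set: T] (if (1 <= i <= n)%N then Y i else cst 0).
    by case: ifPn => ib; [exact: mY|exact: measurable_cst].
  pose xi i : {RV P >-> R} := mfun_Sub (mem_set (mZ i)).
  have xiE i : (1 <= i <= n)%N -> (xi i : T -> R) = Y i.
    by move=> ib; rewrite /xi /= ib.
  have indxi : mutually_independent P [set i : nat | (1 <= i <= n)%N] xi.
    move=> J JK A mA.
    have JE : \bigcap_(i in [set` J]) ((xi i : T -> R) @^-1` A i) =
        \bigcap_(i in [set` J]) (Y i @^-1` A i).
      by apply: eq_bigcapr => i /JK ib; rewrite xiE.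
    rewrite JE (indY J JK A mA); apply: eq_big_seq => i iJ.
    by rewrite xiE//; exact: (JK i iJ).
  have Lxi i : (1 <= i <= n)%N ->
      (xi i : T -> R) \in Lfun P p%:E /\ ('E_P[xi i] = 0)%E.
    move=> ib; rewrite xiE//; split; last exact: EY.
    apply: Lnorm_fin_Lfun; first exact: mY.
    by apply: (@lty_poweRy _ _ p); rewrite ?gt_eqF// (le_lt_trans (le_Sp i ib)).
  have := HC _ _ P n xi n1 indxi Lxi.
  under eq_big_nat => i ib do rewrite xiE//.
  under [X in (X `^ p^-1)%E]eq_big_nat => i ib do rewrite xiE//.
  rewrite (_ : (fun w => \big[Num.max/0]_(1 <= m < n.+1)
                  `|\sum_(1 <= i < m.+1) xi i w|) =
     (fun w => \big[Num.max/0]_(1 <= m < n.+1)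
                `|\sum_(1 <= i < m.+1) Y i w|))//.
  apply/funext => w; apply: eq_big_nat => m mb; congr (`|_|).
  by apply: eq_big_nat => i ib; rewrite xiE//; lia.
Qed.

(** * Sums over dyadic levels *)

Section weights.
Context (R : realType).
Implicit Types q : R.

Lemma geometric_tail (r : R) (m n : nat) : 1 < r ->
  \sum_(0 <= k < n | (m <= k)%N) r ^- k <= r / (r - 1) * r ^- m.
Proof.
move=> r1; have r0 : 0 < r by exact: lt_trans r1.
have c0 : 0 < r - 1 by rewrite subr_gt0.
suff H : (m <= n)%N -> \sum_(0 <= k < n | (m <= k)%N) r ^- k <=
    r / (r - 1) * (r ^- m - r ^- n).
  have cp : 0 <= r / (r - 1) by rewrite divr_ge0 ?ltW.
  have [mn|nm] := leqP m n.
    apply: le_trans (H mn) _; apply: ler_wpM2l => //.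
    by rewrite gerBl invr_ge0 exprn_ge0 ?ltW.
  rewrite big_nat_cond big_pred0.
    by rewrite mulr_ge0// invr_ge0 exprn_ge0 ?ltW.
  by move=> i; apply/negbTE/negP; lia.
elim: n => [|n IH].
  by rewrite leqn0 => /eqP->; rewrite big_geq// subrr mulr0.
rewrite leq_eqVlt => /predU1P[->|]; last rewrite ltnS => mn.
  rewrite subrr mulr0 big_nat_cond big_pred0// => i.
  by apply/negbTE/negP; lia.
rewrite big_mkcond big_nat_recr//= -big_mkcond/= mn.
apply: le_trans (lerD (IH mn) (lexx _)) _.
rewrite le_eqVlt; apply/orP; left; apply/eqP.
by rewrite exprS invfM; field; rewrite !gt_eqF// exprn_gt0.
Qed.

Definition root2 q : R := 2 `^ q^-1.

Lemma root2_gt1 q : 0 < q -> 1 < root2 q.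
Proof.
move=> q0; rewrite /root2 -{1}(powRr0 2) /powR ?pnatr_eq0/= mul0r.
by rewrite ltr_expR mulr_gt0 ?invr_gt0 ?ln_gt0 ?ltr1n.
Qed.

Lemma root2_le2 q : 1 <= q -> root2 q <= 2.
Proof.
move=> q1; rewrite /root2 -[leRHS]powRr1//.
apply: ler_powR; first by rewrite ler1n.
by rewrite invf_le1// (lt_le_trans ltr01).
Qed.

Lemma powR_root2 q k : (2 ^ k)%:R `^ q^-1 = root2 q ^+ k.
Proof.
by rewrite natrX -powR_mulrn// -powRrM mulrC powRrM powR_mulrn// powR_ge0.
Qed.

Lemma powR2_root2 q (d : nat) : 2 `^ (d%:R / q) = root2 q ^+ d.
Proof. by rewrite mulrC powRrM powR_mulrn// powR_ge0. Qed.

(** The condition j <= 2 ^ k means up_log 2 j <= k, and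
    2 ^ up_log 2 j >= j >= (j + 1) / 2; the last step costs one more factor
    root2 q. *)
Lemma dyadic_weight_le q (j n : nat) : 1 <= q -> (1 <= j)%N ->
  \sum_(0 <= k < n | (j <= 2 ^ k)%N) root2 q ^- k <=
  root2 q ^+ 2 / (root2 q - 1) * (j.+1%:R `^ q^-1)^-1.
Proof.
move=> q1 j1; have q0 : 0 < q by exact: lt_le_trans q1.
have r1 := root2_gt1 q0; have r0 := lt_trans ltr01 r1.
have jE k : (j <= 2 ^ k)%N = (up_log 2 j <= k)%N.
  apply/idP/idP => [|jk]; first exact: up_log_min.
  by rewrite (leq_trans (up_logP j (ltnSn 1)))// leq_exp2l.
under eq_bigl do rewrite jE.
apply: le_trans (geometric_tail _ _ r1) _.
rewrite expr2 -!mulrA; apply: ler_wpM2l; first exact: ltW.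
rewrite mulrCA; apply: ler_wpM2l; first by rewrite invr_ge0 subr_ge0 ltW.
rewrite -ler_pdivrMl// -invfM lef_pV2 ?posrE ?mulr_gt0 ?exprn_gt0 ?powR_gt0//.
rewrite -powR_root2 /root2 -powRM//.
have q0' := ltW q0.
apply: ge0_ler_powR; rewrite ?nnegrE ?invr_ge0 ?mulr_ge0//.
rewrite -natrM ler_nat.
have := up_logP j (ltnSn 1); lia.
Qed.
End weights.

Section extended_sums.
Context (R : realType).
Implicit Types (q : R) (delta : nat -> \bar R).
Local Open Scope ereal_scope.

Lemma lq_norm_le q n (N : nat -> \bar R) (B : \bar R) : (0 < q)%R ->
  (forall l, 0 <= N l) -> (forall l, (1 <= l <= n)%N -> N l <= B) -> 0 <= B ->
  (\sum_(1 <= l < n.+1) N l `^ q) `^ q^-1 <= (n%:R `^ q^-1)%:E * B.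
Proof.
move=> q0 N0 NB B0.
have qV0 : (0 <= q^-1)%R by rewrite invr_ge0 ltW.
have -> : (n%:R `^ q^-1)%:E * B = (n%:R%:E * B `^ q) `^ q^-1.
  rewrite poweRM ?poweR_ge0 ?lee_fin// -poweRrM divff ?gt_eqF// poweRe1//.
apply: gt0_ler_poweR => //.
- by rewrite in_itv/= leey andbT sume_ge0// => i _; exact: poweR_ge0.
- by rewrite in_itv/= leey andbT mule_ge0// ?poweR_ge0// lee_fin.
apply: (@le_trans _ _ (\sum_(1 <= l < n.+1) B `^ q)).
  rewrite big_nat [leRHS]big_nat; apply: lee_sum => l lb.
  apply: gt0_ler_poweR; rewrite ?in_itv/= ?leey ?N0 ?B0//; first exact: ltW.
  exact: NB.
by rewrite sumr_const_nat subn1 /= mule_natl.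
Qed.

(** After exchanging the sums, delta j gets the weight of the levels k such that
    j <= 2 ^ k. *)
Lemma weighted_dyadic_sum q delta d n : (1 <= q)%R ->
  (forall j, 0 <= delta j) -> (n <= d.+1)%N ->
  \sum_(0 <= k < n)
    ((root2 q ^+ (d - k))%:E * \sum_(1 <= j < (2 ^ k).+1) delta j)
  <= (root2 q ^+ d * (root2 q ^+ 2 / (root2 q - 1)))%:E *
     \sum_(1 <= j < (2 ^ d).+1) delta j * ((j.+1%:R `^ q^-1)^-1)%:E.
Proof.
move=> q1 d0 nd; have q0 : (0 < q)%R by exact: lt_le_trans q1.
have r1 := root2_gt1 q0; have r0 := lt_trans ltr01 r1.
have c0 : (0 <= root2 q ^+ d * (root2 q ^+ 2 / (root2 q - 1)))%R.
  by rewrite mulr_ge0 ?divr_ge0 ?exprn_ge0 ?subr_ge0// ltW.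
have w0 k : (0 <= root2 q ^+ k)%R by rewrite exprn_ge0// ltW.
rewrite ge0_sume_distrr; last first.
  by move=> j _; rewrite mule_ge0// lee_fin invr_ge0 powR_ge0.
rewrite (eq_big_nat _ _ (F2 := fun k => \sum_(1 <= j < (2 ^ d).+1)
    (if (j <= 2 ^ k)%N
     then (root2 q ^+ d * root2 q ^- k)%:E * delta j else 0)));
    last first.
  move=> k /andP[_ kn]; have kd : (k <= d)%N by lia.
  rewrite ge0_sume_distrr//.
  rewrite [RHS](@big_cat_nat _ _ _ (2 ^ k).+1)//=; last first.
    by rewrite ltnS leq_exp2l.
  rewrite [X in _ = _ + X]big_nat_cond [X in _ = _ + X]big1 ?adde0; last first.
    by move=> j /andP[/andP[jk _] _]; rewrite leqNgt jk.
  apply: eq_big_nat => j /andP[_ jk]; rewrite -ltnS jk.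
  by congr (_%:E * _); rewrite expfB_cond ?gt_eqF//= ?kd.
rewrite exchange_big_nat/= big_nat [leRHS]big_nat.
apply: lee_sum => j /andP[j1 _].
rewrite -big_mkcond/= -ge0_sume_distrl; last first.
  by move=> k _; rewrite lee_fin mulr_ge0// invr_ge0.
rewrite sumEFin -mulr_sumr.
rewrite [leRHS]muleCA [leLHS]muleC lee_wpmul2l// -EFinM lee_fin -mulrA.
by rewrite ler_wpM2l//; exact: dyadic_weight_le.
Qed.

End extended_sums.

(** * The bounds for the maximum *)

Section maximal_bounds.
Context (R : realType) (disp : measure_display) (Om : measurableType disp)
  (P : probability Om R) (disp' : measure_display) (E : measurableType disp').
Variables (eta : nat -> {RV P >-> E})
  (f : forall n : nat, {mfun n.+1.-tuple E >-> R}).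
Hypothesis eta_indep : mutually_independent P [set: nat] eta.
Hypothesis X_int : forall n, (1 <= n)%N -> X_ f eta n \in Lfun P 1%E.
Hypothesis X_centered : forall n, (1 <= n)%N -> ('E_P[X_ f eta n] = 0)%E.
Variables (EX : nat -> nat -> nat -> Om -> R).
Hypothesis EXE : forall k l j, (1 <= l)%N ->
  (l.-1 * 2 ^ k + 1 <= j <= l * 2 ^ k)%N ->
  is_condexp P (G_ eta (l * 2 ^ k) (2 ^ k - 1)) (X_ f eta j) (EX k l j).
Variable T : nat -> nat -> Om -> R.
Hypothesis T0E : forall l, (1 <= l)%N ->
  is_condexp P (G_ eta l 0) (X_ f eta l) (T 0%N l).
Hypothesis TSE : forall k l, (1 <= l)%N ->
  is_condexp P (G_ eta (l * 2 ^ k.+1) (2 ^ k.+1 - 1))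
    (fun w => U_ f eta EX k (2 * l - 1) w + U_ f eta EX k (2 * l) w)
    (T k.+1 l).

Let mU k l : (1 <= l)%N -> measurable_fun [set: Om] (U_ f eta EX k l).
Proof. by move=> l1; exact: Lfun1_measurable (U_L1 X_int EXE k l1). Qed.

Let mT k l : (1 <= l)%N -> measurable_fun [set: Om] (T k l).
Proof.
move=> l1.
exact: Lfun1_measurable (T_L1 X_int X_centered EXE T0E TSE k l1).
Qed.

Let mX l : (1 <= l)%N -> measurable_fun [set: Om] (X_ f eta l).
Proof. by move=> l1; exact: Lfun1_measurable (X_int l1). Qed.

Let Cp p := @rosenthal_constant R p.

Lemma Lnorm_max_S_le (p : R) (d : nat) : 2 <= p ->
  ('N[P]_p%:E[EFin \o (fun w => \big[Num.max/0]_(1 <= n < (2 ^ d).+1)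
                                `|S_ f eta n w|)%R] <=
   \sum_(0 <= k < d.+1)
        (\sum_(1 <= l < (2 ^ (d - k)).+1)
           'N[P]_p%:E[EFin \o U_ f eta EX k l] `^ p) `^ p^-1
      + Cp p * \sum_(0 <= k < d.+1)
        ((\sum_(1 <= l < (2 ^ (d - k)).+1)
            'N[P]_2%:E[EFin \o T k l] `^ 2) `^ 2^-1
       + (\sum_(1 <= l < (2 ^ (d - k)).+1)
            'N[P]_p%:E[EFin \o T k l] `^ p) `^ p^-1))%E.
Proof.
move=> p2; have p1 : 1 <= p by apply: le_trans p2; rewrite ler1n.
have p0 : 0 < p by exact: lt_le_trans p2.
have ge1 a n : a \in index_iota 1 n -> (1 <= a)%N.
  by rewrite mem_index_iota => /andP[].
pose MU k w := \big[Num.max/0]_(1 <= l < (2 ^ (d - k)).+1) `|U_ f eta EX k l w|.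
pose MT k w := \big[Num.max/0]_(1 <= m < (2 ^ (d - k)).+1)
                 `|\sum_(1 <= l < m.+1) T k l w|.
have mMU k : measurable_fun [set: Om] (MU k).
  apply: measurable_bigmax => l /ge1 l1.
  by apply: measurableT_comp => //; exact: mU.
have mMT k : measurable_fun [set: Om] (MT k).
  apply: measurable_bigmax => m _; apply: measurableT_comp => //.
  by apply: measurable_sum_seq => l /ge1 l1; exact: mT.
have mSU : measurable_fun [set: Om] (fun w => \sum_(0 <= k < d.+1) MU k w).
  by apply: measurable_sum_seq => k _; exact: mMU.
have mST : measurable_fun [set: Om] (fun w => \sum_(0 <= k < d.+1) MT k w).
  by apply: measurable_sum_seq => k _; exact: mMT.
have H1 : ('N[P]_p%:E[EFin \o (fun w => \big[Num.max/0]_(1 <= n < (2 ^ d).+1)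
                                `|S_ f eta n w|)%R] <=
  'N[P]_p%:E[EFin \o ((fun w => \sum_(0 <= k < d.+1) MU k w) \+
                      (fun w => \sum_(0 <= k < d.+1) MT k w))%R])%E.
  apply: le_Lnorm_ae => //.
  - apply: measurable_bigmax => n _; apply: measurableT_comp => //.
    by apply: measurable_sum_seq => l /ge1 l1; exact: mX.
  - exact: measurable_funD.
  - apply: filterS (max_S_le X_int EXE T0E TSE d) => w Hw.
    rewrite ger0_norm ?bigmax_nat_ge0// ger0_norm//.
    by rewrite addr_ge0// sumr_ge0// => k _; exact: bigmax_nat_ge0.
apply: (le_trans H1).
apply: (le_trans (minkowski_EFin P mSU mST p1)).
apply: leeD.
  apply: (le_trans (Lnorm_sum_le P (fun k _ => mMU k) p1)).
  apply: lee_sum => k _; apply: Lnorm_bigmax_le => // l /ge1; exact: mU.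
apply: (le_trans (Lnorm_sum_le P (fun k _ => mMT k) p1)).
rewrite ge0_sume_distrr; last by move=> k _; rewrite adde_ge0 ?poweR_ge0.
apply: lee_sum => k _; apply: rosenthal_maximal => //.
- by rewrite expn_gt0.
- by move=> i /andP[i1 _]; exact: mT.
- apply: (T_independent eta_indep X_int X_centered EXE T0E TSE).
  by move=> i /= /andP[].
- move=> i /andP[i1 _].
  exact: (expectation_T X_int X_centered EXE T0E TSE).
Qed.

Variable eta' : nat -> {RV P >-> E}.
Hypothesis copy : independent_copy P eta eta'.

Local Notation delta := (delta_star P f eta eta').

Lemma delta_star_ge0 q j : (0 <= delta q j)%E.
Proof.
case: j => [|n] /=.
  apply: (@le_trans _ _ ('N[P]_q%:E[EFin \o X_ f eta 1])%E).
    exact: Lnorm_ge0.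
  by apply: ereal_sup_ubound; exists 1%N.
apply: (@le_trans _ _ (ereal_sup
  [set ('N[P]_q%:E[EFin \o (X_ f eta k \- X'_ f eta eta' k n)%R])%E
  | k in [set k | (n + 1 <= k)%N]])); last first.
  by apply: ereal_sup_ubound; exists n => /=.
apply: (@le_trans _ _
    ('N[P]_q%:E[EFin \o (X_ f eta n.+1 \- X'_ f eta eta' n.+1 n)%R])%E).
  exact: Lnorm_ge0.
by apply: ereal_sup_ubound; exists n.+1 => //=; rewrite addn1.
Qed.

(** For q = 2 this is 2 ^ (3/2) / (sqrt 2 - 1). *)
Definition dyadic_const (q : R) : R := 2 `^ (1 + q^-1) / (2 `^ q^-1 - 1).

Lemma dyadic_constE q : dyadic_const q = 2 * root2 q / (root2 q - 1).
Proof.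
by rewrite /dyadic_const powRD ?powRr1//; apply/implyP => _; rewrite pnatr_eq0.
Qed.

Let wdelta q d := (\sum_(0 <= j < (2 ^ d).+1)
  delta q j * ((j.+1%:R `^ q^-1)^-1)%:E)%E.

Let Dq q k := (\sum_(1 <= j < (2 ^ k).+1) delta q j)%E.

Let Dq_ge0 q k : (0 <= Dq q k)%E.
Proof. by apply: sume_ge0 => j _; exact: delta_star_ge0. Qed.

Let wterm_ge0 q j : (0 <= delta q j * ((j.+1%:R `^ q^-1)^-1)%:E)%E.
Proof. by rewrite mule_ge0 ?delta_star_ge0// lee_fin invr_ge0 powR_ge0. Qed.

(** The geometric series gives root2 q ^ 2 in place of the numerator
    2 * root2 q, and root2 q <= 2. *)
Lemma sum_Lnorm_U_le q d : 1 <= q ->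
  (\sum_(0 <= k < d.+1) (\sum_(1 <= l < (2 ^ (d - k)).+1)
      'N[P]_q%:E[EFin \o U_ f eta EX k l] `^ q) `^ q^-1 <=
   (dyadic_const q)%:E * (root2 q ^+ d)%:E * wdelta q d)%E.
Proof.
move=> q1; have q0 : 0 < q by exact: lt_le_trans q1.
have r1 := root2_gt1 q0; have r0 := lt_trans ltr01 r1.
have r1' := ltW r1; have r0' := ltW r0.
have rd0 : 0 <= root2 q ^+ d by rewrite exprn_ge0// ltW.
apply: (@le_trans _ _ (\sum_(0 <= k < d.+1)
    ((root2 q ^+ (d - k))%:E * Dq q k)))%E.
  apply: lee_sum => k _; rewrite -powR_root2; apply: lq_norm_le => //.
    by move=> l; exact: Lnorm_ge0.
  move=> l /andP[l1 _]; exact: Lnorm_U_le.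
apply: (le_trans (weighted_dyadic_sum q1 (delta_star_ge0 q) (leqnn d.+1))).
rewrite -EFinM lee_pmul//.
- by rewrite lee_fin mulr_ge0// divr_ge0 ?exprn_ge0 ?subr_ge0// ltW.
- by apply: sume_ge0.
- rewrite lee_fin mulrC ler_wpM2r// dyadic_constE expr2.
  rewrite ler_wpM2r ?invr_ge0 ?subr_ge0//.
  by rewrite ler_wpM2r ?root2_le2.
- by rewrite /wdelta [leRHS]big_ltn// leeDr.
Qed.

(** Level 0 gives the term j = 0. Level k + 1 is bounded by twice the sum of
    level k with the weight of level k + 1, that is by 2 / root2 q times the
    term of level k in the sum for U. *)
Lemma sum_Lnorm_T_le q d : 1 <= q ->
  (\sum_(0 <= k < d.+1) (\sum_(1 <= l < (2 ^ (d - k)).+1)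
      'N[P]_q%:E[EFin \o T k l] `^ q) `^ q^-1 <=
   (dyadic_const q)%:E * (root2 q ^+ d)%:E * wdelta q d)%E.
Proof.
move=> q1; have q0 : 0 < q by exact: lt_le_trans q1.
have r1 := root2_gt1 q0; have r0 := lt_trans ltr01 r1.
have r1' := ltW r1; have r0' := ltW r0.
have rd0 : 0 <= root2 q ^+ d by rewrite exprn_ge0// ltW.
have c0 : 0 <= 2 / root2 q by rewrite divr_ge0// ltW.
have c1 : 1 <= dyadic_const q.
  rewrite dyadic_constE ler_pdivlMr ?subr_gt0// mul1r; lra.
rewrite big_nat_recl// /wdelta [X in (_ <= _ * X)%E]big_ltn//.
rewrite ge0_muleDr; last 2 first.
- exact: wterm_ge0.
- by apply: sume_ge0.
apply: leeD.
  apply: (@le_trans _ _ ((root2 q ^+ d)%:E * delta q 0))%E.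
    rewrite subn0 -powR_root2; apply: lq_norm_le => //.
    + by move=> l; exact: Lnorm_ge0.
    + by move=> l /andP[l1 _]; exact: Lnorm_T0_le.
    + exact: delta_star_ge0.
  rewrite powR1 invr1 mule1 lee_wpmul2r ?delta_star_ge0//.
  by rewrite -EFinM lee_fin ler_peMl.
apply: (@le_trans _ _ ((2 / root2 q)%:E *
    \sum_(0 <= k < d) ((root2 q ^+ (d - k))%:E * Dq q k)))%E.
  rewrite ge0_sume_distrr; last first.
    by move=> k _; rewrite mule_ge0// lee_fin exprn_ge0// ltW.
  rewrite big_nat [leRHS]big_nat; apply: lee_sum => k /andP[_ kd].
  rewrite muleA -EFinM.
  have -> : 2 / root2 q * root2 q ^+ (d - k) = root2 q ^+ (d - k.+1) * 2.
    have -> : (d - k = (d - k.+1).+1)%N by lia.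
    by rewrite exprS; field; rewrite gt_eqF.
  rewrite EFinM -muleA -powR_root2; apply: lq_norm_le => //.
  - by move=> l; exact: Lnorm_ge0.
  - move=> l /andP[l1 _]; rewrite mule_natl mule2n.
    exact: (Lnorm_TS_le eta_indep X_int EXE TSE copy k q1 l1).
  - by apply: mule_ge0; rewrite ?lee_fin ?Dq_ge0.
apply: (@le_trans _ _ ((2 / root2 q)%:E *
   ((root2 q ^+ d * (root2 q ^+ 2 / (root2 q - 1)))%:E *
     \sum_(1 <= j < (2 ^ d).+1) delta q j * ((j.+1%:R `^ q^-1)^-1)%:E)))%E.
  rewrite lee_wpmul2l//.
  exact: (weighted_dyadic_sum q1 (delta_star_ge0 q) (leqnSn d)).
rewrite muleA -!EFinM le_eqVlt; apply/orP; left; apply/eqP; congr (_%:E * _)%E.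
by rewrite dyadic_constE; field; rewrite subr_eq0 !gt_eqF.
Qed.

End maximal_bounds.

Theorem proposition15 (R : realType)
    (disp : measure_display) (Om : measurableType disp) (P : probability Om R)
    (disp' : measure_display) (E : measurableType disp')
    (eta : nat -> {RV P >-> E})
    (eta_indep : mutually_independent P [set: nat] eta)
    (f : forall n : nat, {mfun n.+1.-tuple E >-> R})
    (X_int : forall n, (1 <= n)%N -> X_ f eta n \in Lfun P 1%E)
    (X_centered : forall n, (1 <= n)%N -> ('E_P[X_ f eta n] = 0)%E)
    (EX : nat -> nat -> nat -> Om -> R)
    (EXE : forall k l j, (1 <= l)%N ->
       (l.-1 * 2 ^ k + 1 <= j <= l * 2 ^ k)%N ->
       is_condexp P (G_ eta (l * 2 ^ k) (2 ^ k - 1)) (X_ f eta j) (EX k l j))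
    (T : nat -> nat -> Om -> R)
    (T0E : forall l, (1 <= l)%N ->
       is_condexp P (G_ eta l 0) (X_ f eta l) (T 0%N l))
    (TSE : forall k l, (1 <= l)%N ->
       is_condexp P (G_ eta (l * 2 ^ k.+1) (2 ^ k.+1 - 1))
         (fun w => U_ f eta EX k (2 * l - 1) w + U_ f eta EX k (2 * l) w)
         (T k.+1 l)) :
  (forall d : nat, {ae P, forall w,
     \big[Num.max/0]_(1 <= n < (2 ^ d).+1) `|S_ f eta n w|
     <= \sum_(0 <= k < d.+1)
          \big[Num.max/0]_(1 <= l < (2 ^ (d - k)).+1) `|U_ f eta EX k l w|
      + \sum_(0 <= k < d.+1)
          \big[Num.max/0]_(1 <= m < (2 ^ (d - k)).+1)
             `|\sum_(1 <= l < m.+1) T k l w| })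
  /\
  (forall p : R, 2 <= p ->
     (forall n, (1 <= n)%N -> X_ f eta n \in Lfun P p%:E) ->
   forall d : nat,
   let Cp := rosenthal_constant p in
   let C'p := (Cp * (2 `^ (3 / 2) / (Num.sqrt 2 - 1))%:E)%E in
   let C''p := ((2 `^ (1 + p^-1))%:E * (Cp + 1) * (2 `^ p^-1 - 1)^-1%:E)%E in
   let rhs :=
     (\sum_(0 <= k < d.+1)
        (\sum_(1 <= l < (2 ^ (d - k)).+1)
           'N[P]_p%:E[EFin \o U_ f eta EX k l] `^ p) `^ p^-1
      + Cp * \sum_(0 <= k < d.+1)
        ((\sum_(1 <= l < (2 ^ (d - k)).+1)
            'N[P]_2%:E[EFin \o T k l] `^ 2) `^ 2^-1
       + (\sum_(1 <= l < (2 ^ (d - k)).+1)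
            'N[P]_p%:E[EFin \o T k l] `^ p) `^ p^-1))%E in
     ('N[P]_p%:E[EFin \o (fun w => \big[Num.max/0]_(1 <= n < (2 ^ d).+1)
                                `|S_ f eta n w|)%R] <= rhs)%E
     /\
     (forall eta' : nat -> {RV P >-> E}, independent_copy P eta eta' ->
        (rhs <=
           C'p * (2 `^ (d%:R / 2))%:E
             * \sum_(0 <= j < (2 ^ d).+1)
                 delta_star P f eta eta' 2 j * ((j.+1%:R `^ 2^-1)^-1)%:E
         + C''p * (2 `^ (d%:R / p))%:E
             * \sum_(0 <= j < (2 ^ d).+1)
                 delta_star P f eta eta' p j * ((j.+1%:R `^ p^-1)^-1)%:E)%E)).
Proof.
split; first by move=> d; exact: (max_S_le X_int EXE T0E TSE).
move=> p p2 _ d Cp C'p C''p rhs.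
have p1 : 1 <= p by apply: le_trans p2; rewrite ler1n.
split; first exact: (Lnorm_max_S_le eta_indep X_int X_centered EXE T0E TSE).
move=> eta' copy.
have Cp0 : (0 <= Cp)%E.
  by apply: le_trans (rosenthal_constant_ge p2); rewrite lee_fin invr_ge0.
have HU := sum_Lnorm_U_le eta_indep X_int EXE copy d p1.
have HTp := sum_Lnorm_T_le eta_indep X_int EXE T0E TSE copy d p1.
have HT2 := sum_Lnorm_T_le eta_indep X_int EXE T0E TSE copy d
  (ler1n _ 2 : 1 <= 2 :> R).
have c2E : 2 `^ (3 / 2) / (Num.sqrt 2 - 1) = dyadic_const 2 :> R.
  rewrite /dyadic_const -powR12_sqrt//; congr (_ `^ _ / _); by field.
have cpE : 2 `^ (1 + p^-1) * (2 `^ p^-1 - 1)^-1 = dyadic_const p by [].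
set Dp := (\sum_(0 <= j < (2 ^ d).+1)
    delta_star P f eta eta' p j * ((j.+1%:R `^ p^-1)^-1)%:E)%E in HU HTp *.
set D2 := (\sum_(0 <= j < (2 ^ d).+1)
    delta_star P f eta eta' 2 j * ((j.+1%:R `^ 2^-1)^-1)%:E)%E in HT2 *.
rewrite /rhs /C'p /C''p c2E !powR2_root2.
rewrite big_split/=.
apply: (le_trans (leeD HU (lee_wpmul2l Cp0 (leeD HT2 HTp)))).
have c0 q : 1 <= q -> 0 <= dyadic_const q :> R.
  move=> q1; rewrite divr_ge0 ?powR_ge0// subr_ge0 ltW//.
  by apply: root2_gt1; exact: lt_le_trans q1.
have r0 q : 0 <= root2 q ^+ d :> R by rewrite exprn_ge0// powR_ge0.
have D0 (q : R) : (0 <= \sum_(0 <= j < (2 ^ d).+1)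
    delta_star P f eta eta' q j * ((j.+1%:R `^ q^-1)^-1)%:E)%E.
  apply: sume_ge0 => j _; apply: mule_ge0; first exact: delta_star_ge0.
  by rewrite lee_fin invr_ge0 powR_ge0.
set B2 := (_ * D2)%E; set Bp := (_ * Dp)%E.
have B20 : (0 <= B2)%E.
  apply: mule_ge0; last exact: D0.
  by apply: mule_ge0; rewrite lee_fin ?r0// c0// ler1n.
have Bp0 : (0 <= Bp)%E.
  apply: mule_ge0; last exact: D0.
  by apply: mule_ge0; rewrite lee_fin ?r0// c0.
have -> : (Cp * (dyadic_const 2)%:E * (root2 2 ^+ d)%:E * D2 = Cp * B2)%E.
  by rewrite /B2 !muleA.
have -> : ((2 `^ (1 + p^-1))%:E * (Cp + 1) * ((2 `^ p^-1 - 1)^-1)%:E *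
    (root2 p ^+ d)%:E * Dp = Cp * Bp + Bp)%E.
  rewrite [X in (X * _ * _ * _)%E]muleC -(muleA (Cp + 1)%E) -EFinM cpE.
  by rewrite -!muleA ge0_muleDl// mul1e /Bp !muleA.
by rewrite ge0_muleDr// addeC -addeA.
Qed.
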